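(* For every integer $d\ge5$ there exist constants $c_d,C_d,C'_d,K_d>0$ depending only on $d$ such that for every $\lambda\ge 1$ with $\lambda^2\in\mathbb{N}$ and every $r>0$ with $r\le c_d\lambda^{-\frac1{d-1}}$, $$m_d(\lambda,r)\le K_d\bigl(C'_d\,r\,\lambda^{\frac{1}{d-1}}\bigr)^{C_d\lambda^{\frac{d-2}{d-1}}}.$$
   Context: Let $\mathbb{T}^d=\mathbb{R}^d/(2\pi\mathbb{Z})^d$ and $\mathcal{E}_d(\lambda)=\{u\in C^\infty(\mathbb{T}^d): -\Delta u=\lambda^2u\}$. Write $\fint_\Omega f\,dx=\frac{1}{|\Omega|}\int_\Omega f\,dx$ for the average, $B_r=\{x\in\mathbb{R}^d:|x|<r\}$, and regard functions on $\mathbb{T}^d$ as periodic functions on $\mathbb{R}^d$. The observability constant is $$m_d(\lambda,r)=\inf_{0\ne u\in\mathcal{E}_d(\lambda)}\frac{\fint_{B_r}|u(x)|^2\,dx}{\fint_{\mathbb{T}^d}|u(x)|^2\,dx}.$$ *)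

(* Defs.v *)
From HB Require Import structures.
From mathcomp Require Import all_boot all_order all_algebra.
From mathcomp Require Import all_classical all_reals all_analysis.
From mathcomp.real_closed Require Import complex.

Set Implicit Arguments.
Unset Strict Implicit.
Unset Printing Implicit Defensive.

Import Order.TTheory GRing.Theory Num.Theory.
Import numFieldNormedType.Exports.

Local Open Scope classical_set_scope.
Local Open Scope ring_scope.

Section row_vector_measurable.
Context {disp} {T : sigmaRingType disp}.
Variable n : nat.

Let coors : 'I_n -> 'rV[T]_n -> T := fun i x => x ord0 i.

Let rV_set0 : g_sigma_preimage coors set0.
Proof. exact: sigma_algebra0. Qed.

Let rV_setC A : g_sigma_preimage coors A -> g_sigma_preimage coors (~` A).
Proof. exact: sigma_algebraC. Qed.

Let rV_bigcup (F : _^nat) : (forall i, g_sigma_preimage coors (F i)) ->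
  g_sigma_preimage coors (\bigcup_i (F i)).
Proof. exact: sigma_algebra_bigcup. Qed.

HB.instance Definition _ := @isMeasurable.Build (measure_tuple_display disp)
  'rV[T]_n (g_sigma_preimage coors) rV_set0 rV_setC rV_bigcup.

End row_vector_measurable.

Section row_cons.
Context {R : realType}.
Variable n : nat.

Definition row_cons (p : R * 'rV[R]_n) : 'rV[R]_n.+1 :=
  \row_i oapp (p.2 ord0) p.1 (unlift ord0 i).

Definition row_uncons (x : 'rV[R]_n.+1) : R * 'rV[R]_n :=
  (x ord0 ord0, \row_i x ord0 (lift ord0 i)).

Lemma row_consK : cancel row_cons row_uncons.
Proof.
case=> a x; rewrite /row_uncons /row_cons !mxE unlift_none /=; congr (_, _).
by apply/rowP => i; rewrite !mxE liftK.
Qed.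

Lemma row_unconsK : cancel row_uncons row_cons.
Proof.
move=> x; apply/rowP => i; rewrite /row_cons /row_uncons mxE.
by case: (unliftP ord0 i) => [j|] -> /=; rewrite ?mxE.
Qed.

End row_cons.

Lemma measurable_coord {R : realType} n (i : 'I_n) :
  measurable_fun [set: 'rV[R]_n] (fun x => x ord0 i).
Proof.
move=> _ Y mY; rewrite setTI; apply: sub_sigma_algebra => /=.
rewrite -bigcup_seq/=; exists i => /=; first by rewrite mem_index_enum.
by exists Y => //; rewrite setTI.
Qed.

Lemma measurable_fun_rV {R : realType} d (T : measurableType d) n
    (f : T -> 'rV[R]_n) :
  (forall i, measurable_fun [set: T] (fun t => f t ord0 i)) ->
  measurable_fun [set: T] f.
Proof.
move=> mf.
have pf : g_sigma_preimage (fun i t => f t ord0 i) `<=` @measurable _ T.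
  apply: smallest_sub; first exact: sigma_algebra_measurable.
  case: n => [|n] in f mf *; first by rewrite big_ord0.
  rewrite -bigcup_mkord_ord; apply: bigcup_sub => i Ii.
  by move=> A [B mB <-]; exact: mf.
move=> _ A mA; apply: pf.
rewrite (_ : (fun i t => _) = (fun i => (fun x : 'rV[R]_n => x ord0 i) \o f))//.
by rewrite g_sigma_preimage_comp; exists A.
Qed.

Lemma measurable_row_cons {R : realType} n :
  measurable_fun [set: R * 'rV[R]_n] (@row_cons R n).
Proof.
apply: measurable_fun_rV => i; case: (unliftP ord0 i) => [j|] ->.
- have -> : (fun t : R * 'rV[R]_n => row_cons t ord0 (lift ord0 j)) =
            (fun x : 'rV[R]_n => x ord0 j) \o snd.
    by apply/funext => t; rewrite mxE liftK.
  by apply: measurableT_comp => //; exact: measurable_coord.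
- have -> : (fun t : R * 'rV[R]_n => row_cons t ord0 ord0) = fst.
    by apply/funext => t; rewrite mxE unlift_none.
  exact: measurable_fst.
Qed.

Lemma measurable_row_uncons {R : realType} n :
  measurable_fun [set: 'rV[R]_n.+1] (@row_uncons R n).
Proof.
apply: measurable_fun_pair; first exact: measurable_coord.
apply: measurable_fun_rV => i.
have -> : (fun t : 'rV[R]_n.+1 => (\row_j t ord0 (lift ord0 j)) ord0 i) =
          (fun t : 'rV[R]_n.+1 => t ord0 (lift ord0 i)).
  by apply/funext => t; rewrite mxE.
exact: measurable_coord.
Qed.

Lemma sigma_finite_product d1 d2 (T1 : measurableType d1)
    (T2 : measurableType d2) (R : realType)
    (m1 : {sigma_finite_measure set T1 -> \bar R})
    (m2 : {sigma_finite_measure set T2 -> \bar R}) :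
  sigma_finite setT (m1 \x m2)%E.
Proof.
have /sigma_finiteP[F [TF ndF Foo]] := sigma_finiteT m1.
have /sigma_finiteP[G [TG ndG Goo]] := sigma_finiteT m2.
exists (fun k => F k `*` G k).
  rewrite -setXTT TF TG predeqE => -[x y]; split.
    move=> [/= [i _ Fix] [j _ Gjy]]; exists (maxn i j) => //; split.
    - by move: x Fix; exact/subsetPset/ndF/leq_maxl.
    - by move: y Gjy; exact/subsetPset/ndG/leq_maxr.
  by move=> [i _ []/= ? ?]; split; exists i.
move=> k; have [? ?] := Foo k; have [? ?] := Goo k.
split; first exact: measurableX.
by rewrite product_measure1E// lte_mul_pinfty// ge0_fin_numE.
Qed.

Section lebesgue_succ.
Context {R : realType} (n : nat).
Variable mu : {sigma_finite_measure set 'rV[R]_n -> \bar R}.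

Definition lebesgue_succ : set 'rV[R]_n.+1 -> \bar R :=
  pushforward (@lebesgue_measure R \x mu)%E (@row_cons R n).

Let lebesgue_succ0 : lebesgue_succ set0 = 0%E.
Proof. by rewrite /lebesgue_succ /pushforward preimage_set0 measure0. Qed.

Let lebesgue_succ_ge0 A : (0 <= lebesgue_succ A)%E.
Proof. by rewrite /lebesgue_succ /pushforward measure_ge0. Qed.

Let lebesgue_succ_sigma_additive : semi_sigma_additive lebesgue_succ.
Proof.
move=> F mF tF mUF; rewrite /lebesgue_succ /pushforward preimage_bigcup.
apply: measure_semi_sigma_additive.
- by move=> i; rewrite -[X in measurable X]setTI; exact: measurable_row_cons.
- apply/trivIsetP => /= i j _ _ ij; rewrite -preimage_setI.
  by move/trivIsetP : tF => /(_ _ _ _ _ ij) ->//; rewrite preimage_set0.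
- by rewrite -preimage_bigcup -[X in measurable X]setTI;
    exact: measurable_row_cons.
Qed.

HB.instance Definition _ := isMeasure.Build _ _ _ lebesgue_succ
  lebesgue_succ0 lebesgue_succ_ge0 lebesgue_succ_sigma_additive.

Let lebesgue_succ_sigma_finite : sigma_finite setT lebesgue_succ.
Proof.
have [F TF Foo] := sigma_finite_product (@lebesgue_measure R) mu.
exists (fun k => @row_uncons R n @^-1` F k).
  by rewrite -preimage_bigcup -TF preimage_setT.
move=> k; have [mFk Fkoo] := Foo k; split.
  by rewrite -[X in measurable X]setTI; exact: measurable_row_uncons.
rewrite /lebesgue_succ /pushforward -comp_preimage.
by rewrite (_ : _ \o _ = id) //; apply/funext => p; exact: row_consK.
Qed.

HB.instance Definition _ := Measure_isSigmaFinite.Build _ _ _ lebesgue_succ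
  lebesgue_succ_sigma_finite.

End lebesgue_succ.

(* Lebesgue measure on R^n, as an iterated product: R^0 is a point of mass 1
   and R^(n+1) is identified with R * R^n. *)
Fixpoint lebesgue_rV {R : realType} (n : nat) :
    {sigma_finite_measure set 'rV[R]_n -> \bar R} :=
  match n with
  | 0 => \d_(0 : 'rV[R]_0)
  | n'.+1 => lebesgue_succ (lebesgue_rV n')
  end.

Section observability.
Context {R : realType} {d : nat}.
Implicit Types (f : 'rV[R]_d -> R) (u : 'rV[R]_d -> R[i]).

Definition average (A : set 'rV[R]_d) f : R :=
  (\int[lebesgue_rV d]_(x in A) f x) / fine (lebesgue_rV d A).

(* The library norm on 'rV[R]_d is the sup norm, hence the explicit formula. *)
Definition euclid_ball (r : R) : set 'rV[R]_d :=
  [set x : 'rV[R]_d | Num.sqrt (\sum_(i < d) x ord0 i ^+ 2) < r].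

Definition torus_cell : set 'rV[R]_d :=
  [set x : 'rV[R]_d | forall i, 0 <= x ord0 i < 2 * pi].

Definition basis_vec (i : 'I_d) : 'rV[R]_d := delta_mx ord0 i.

Fixpoint is_Ck (k : nat) f : Prop :=
  match k with
  | 0 => continuous f
  | k'.+1 => forall i : 'I_d, (forall x, derivable f x (basis_vec i)) /\
                              is_Ck k' ('D_(basis_vec i) f)
  end.

Definition smooth f : Prop := forall k, is_Ck k f.

Definition laplacian f (x : 'rV[R]_d) : R :=
  \sum_(i < d) 'D_(basis_vec i) ('D_(basis_vec i) f) x.

Definition csmooth u : Prop :=
  smooth (fun x => complex.Re (u x)) /\ smooth (fun x => complex.Im (u x)).

Definition claplacian u (x : 'rV[R]_d) : R[i] :=
  Complex (laplacian (fun y => complex.Re (u y)) x)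
          (laplacian (fun y => complex.Im (u y)) x).

Definition torus_periodic u : Prop :=
  forall (k : 'rV[int]_d) x, u (x + (2 * pi) *: map_mx intr k) = u x.

Definition torus_eigenspace (lam : R) : set ('rV[R]_d -> R[i]) :=
  [set u | [/\ torus_periodic u, csmooth u &
    forall x, - claplacian u x = real_complex R (lam ^+ 2) * u x]].

Definition mean_square (A : set 'rV[R]_d) u : R :=
  average A (fun x => ComplexField.Normc.normc (u x) ^+ 2).

End observability.

(* The infimum is taken in \bar R, so that it is +oo if the eigenspace is
   trivial. *)
Definition observability {R : realType} (d : nat) (lam r : R) : \bar R :=
  ereal_inf [set (mean_square (euclid_ball r) u / mean_square torus_cell u)%:E
            | u in @torus_eigenspace R d lam `\ cst 0].

(* Main.v *)
(** Restricted to the sphere |k|^2 = lam^2, the polynomials of degree < M span a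
    space of dimension at most 2 M^(d-1).  For d >= 5 the sphere carries at least
    c lam^(d-2) integer points, so for some M of order lam^((d-2)/(d-1)) a
    nonzero real combination u = sum_k a_k cos(k.x - pi/4) annihilates all these
    polynomials, i.e. vanishes to order M at the origin.  Taylor's formula gives
    |u| <= (sum |a_k|) (lam r)^M / M! on B_r, and Parseval compares sum |a_k|
    with the mean square of u.

    The count of integer points reduces to: every odd m has at least m / 12
    representations as a sum of four squares.  For a^2 + b^2 = -1 mod m, the
    quaternions mod m are the 2 x 2 matrices mod m, with the norm as determinant,
    and the matrices killing the vectors (s, 1), for s mod m, give m lattices of
    index m^2 on which m divides the norm.  A pigeonhole argument produces in
    each a vector of norm 2m or 4m, which determines s and can be halved to
    norm m. *)
Require Import Defs.
From mathcomp Require Import all_boot all_order all_algebra.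
From mathcomp Require Import all_classical all_reals all_analysis measurable_realfun.
From mathcomp.real_closed Require Import complex.
From mathcomp Require Import zify ring lra.
Set Implicit Arguments.
Unset Strict Implicit.
Unset Printing Implicit Defensive.
Import Order.TTheory GRing.Theory Num.Theory.
Import numFieldNormedType.Exports.
Local Open Scope classical_set_scope.
Local Open Scope ring_scope.

(** * Integer points on spheres *)

(** Pigeonhole: the squares of 0, ..., h with h = (p - 1) / 2 are distinct mod p, so the h + 1
    values a^2 and the h + 1 values - b^2 - 1 cannot all be distinct among p residues; a collision
    must be between the two families. *)
Lemma prime_dvd_sum_two_squares_succ (p : nat) : prime p -> odd p ->
  exists a b : int, (p %| a ^+ 2 + b ^+ 2 + 1)%Z.
Proof.
move=> pp op; have p_gt0 := prime_gt0 pp.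
pose h := p./2.
have hE : p = (h.*2.+1)%N by rewrite -[LHS]odd_double_half op.
(* Here x + y and |x - y| are below p, so p divides their product only if x = y. *)
have sq_inj (x y : nat) : (x <= h)%N -> (y <= h)%N ->
    (p %| (x%:Z ^+ 2 - y%:Z ^+ 2))%Z -> x = y.
  move=> xh yh; rewrite subr_sqr.
  rewrite dvdzE abszM Euclid_dvdM // => /orP[] /dvdnP[q]; rewrite hE.
    by case: q => [|q]; nia.
  by case: q => [|q]; nia.
pose f (u : 'I_h.+1 + 'I_h.+1) : int :=
  match u with inl a => (a : nat)%:Z ^+ 2 | inr b => - (b : nat)%:Z ^+ 2 - 1 end.
have fP u : (`|(f u %% p)%Z| < p)%N.
  have := ltz_pmod (f u) (d := p).
  have := @modz_ge0 (f u) p; lia.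
pose g u : 'I_p := Ordinal (fP u).
have : ~~ injectiveb g.
  apply/negP => /injectiveP /leq_card; rewrite card_sum !card_ord; lia.
case/injectivePn => u [v uv] /(congr1 (fun i : 'I_p => (i : nat)%:Z)) /=.
rewrite !gez0_abs ?modz_ge0 //; try by lia.
move=> /eqP; rewrite eqz_mod_dvd.
case: u v uv => [a|a] [b|b] /= uv H.
- case/negP: uv; apply/eqP; congr inl; apply: val_inj => /=.
  by apply: sq_inj H; rewrite -ltnS.
- by exists a%:Z, b%:Z; move: H; congr (_ %| _)%Z; ring.
- exists b%:Z, a%:Z; have /dvdzP[q Hq] := H.
  by apply/dvdzP; exists (- q); rewrite mulNr -Hq; ring.
- case/negP: uv; apply/eqP; congr inr; apply: val_inj => /=.
  apply: sq_inj; [by rewrite -ltnS | by rewrite -ltnS |]; have /dvdzP[q Hq] := H.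
  by apply/dvdzP; exists (- q); rewrite mulNr -Hq; ring.
Qed.

(** Induction on m = k p with p the least prime factor: a solution (a, b) mod k, with a^2 + b^2 + 1
    = c k, is lifted to (a + k u, b + k v). *)
Lemma dvdz_sum_two_squares_succ (m : nat) : odd m ->
  exists a b : int, (m %| a ^+ 2 + b ^+ 2 + 1)%Z.
Proof.
have [n] := ubnP m; elim: n m => // n IHn m /ltnSE le_mn om.
have [m1|m_gt1] : m = 1%N \/ (1 < m)%N by case: m om {le_mn} => [|[|m]]; auto.
  by exists 0, 0; rewrite m1 dvd1z.
pose p := pdiv m; have pp : prime p by exact: pdiv_prime.
have p_gt0 := prime_gt0 pp; have p_gt1 := prime_gt1 pp.
have /dvdnP[k mE] := pdiv_dvd m; rewrite -/p in mE.
have [ok op] : odd k /\ odd p by move: om; rewrite mE oddM => /andP.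
have [|a [b /dvdzP[c Hc]]] := IHn k _ ok.
  by move: om p_gt1 le_mn; rewrite mE; case: (k) => // k'; nia.
(* This is the condition on the lifted pair mod k p, divided by k. *)
suff [u [v /dvdzP[w Hw]]] : exists u v : int,
    (p %| c + 2 * (a * u + b * v) + k%:Z * (u ^+ 2 + v ^+ 2))%Z.
  exists (a + k%:Z * u), (b + k%:Z * v); apply/dvdzP; exists w.
  rewrite mE PoszM mulrA (mulrAC w) -Hw.
  transitivity ((a ^+ 2 + b ^+ 2 + 1) +
    k%:Z * (2 * (a * u + b * v) + k%:Z * (u ^+ 2 + v ^+ 2))); first ring.
  by rewrite Hc; ring.
have inv (x : int) : ~~ (p %| x)%Z -> exists y z : int, y * x = 1 + z * p%:Z.
  rewrite dvdzE /= -prime_coprime // => co.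
  have /coprimezP[[y z] /= H] : coprimez p x by rewrite coprimezE.
  by exists z, (- y); lia.
(* If p divides k, the quadratic term drops out mod p and the remaining linear congruence is solved
   by inverting 2 a or 2 b; p cannot divide both a and b, as it would then divide 1. *)
have [pk|npk] := boolP (p %| k)%N.
- have /dvdnP[k' kE] := pk.
  have [i2 [j2 E2]] : exists y z : int, y * 2 = 1 + z * p%:Z.
    by apply: inv; rewrite dvdzE /=; apply/negP => /dvdn_leq; lia.
  have [pa|npa] := boolP (p %| a)%Z; last first.
    have [y [z Hy]] := inv _ npa.
    exists (- (i2 * y * c)), 0; apply/dvdzP.
    exists (- (z * c) - j2 * c * (1 + z * p%:Z)
            + k'%:Z * (i2 * y * c) ^+ 2).
    rewrite kE PoszM.
    transitivity (c - (i2 * 2) * (y * a) * c + k'%:Z * p%:Z * (i2 * y * c) ^+ 2).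
      by ring.
    by rewrite E2 Hy; ring.
  have [pb|npb] := boolP (p %| b)%Z.
    have /dvdzP[a' aE] := pa; have /dvdzP[b' bE] := pb.
    have : (p %| 1)%Z.
      apply/dvdzP; exists (c * k'%:Z - a' * a - b' * b).
      transitivity (c * k%:Z - a ^+ 2 - b ^+ 2); first by rewrite -Hc; ring.
      by rewrite kE PoszM; rewrite aE bE; ring.
    by rewrite dvdz1 => /eqP; lia.
  have [y [z Hy]] := inv _ npb.
  exists 0, (- (i2 * y * c)); apply/dvdzP.
  exists (- (z * c) - j2 * c * (1 + z * p%:Z)
          + k'%:Z * (i2 * y * c) ^+ 2).
  rewrite kE PoszM.
  transitivity (c - (i2 * 2) * (y * b) * c + k'%:Z * p%:Z * (i2 * y * c) ^+ 2).
    by ring.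
  by rewrite E2 Hy; ring.
(* If p does not divide k, with y inverse to k mod p, the lift is the Chinese remainder one: a + k u
   and b + k v reduce to a solution (a0, b0) mod p. *)
have [a0 [b0 /dvdzP[q Hq]]] := prime_dvd_sum_two_squares_succ pp op.
have [y [z Hy]] : exists y z : int, y * k%:Z = 1 + z * p%:Z.
  by apply: inv; rewrite dvdzE.
exists (y * (a0 - a)), (y * (b0 - b)).
have copk : coprimez p k by rewrite coprimezE /= prime_coprime.
rewrite -(Gauss_dvdzr _ copk); apply/dvdzP.
exists (q + z * (2 * a0 * (a0 - a) + 2 * b0 * (b0 - b)
   + z * p%:Z * ((a0 - a) ^+ 2 + (b0 - b) ^+ 2))).
transitivity (c * k%:Z + 2 * (y * k%:Z) * (a * (a0 - a) + b * (b0 - b))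
   + (y * k%:Z) ^+ 2 * ((a0 - a) ^+ 2 + (b0 - b) ^+ 2)); first ring.
rewrite Hy -Hc [RHS]mulrDl -Hq; ring.
Qed.

(** * Lattices of integer quaternions whose norm is divisible by m *)

Definition norm4 (v : int * int * int * int) : int :=
  let: (x, y, z, w) := v in x ^+ 2 + y ^+ 2 + z ^+ 2 + w ^+ 2.

(* Mod m, with a^2 + b^2 = -1, the quaternion x + y i + z j + w k is the matrix
   [[x + a z + b w, y + b z - a w], [- y + b z - a w, x - a z - b w]]; the two
   conditions say that it kills the column vector (s, 1). *)
Definition quat_lattice (m : nat) (a b s : int) (v : int * int * int * int) : bool :=
  let: (x, y, z, w) := v in
  (m %| s * (x + a * z + b * w) + (y + b * z - a * w))%Z &&
  (m %| s * (- y + b * z - a * w) + (x - a * z - b * w))%Z.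

(** The determinant of the matrix is the norm minus (a^2 + b^2 + 1)(z^2 + w^2), and it is 0 mod m
    because in each row the second entry is - s times the first. *)
Lemma quat_lattice_norm (m : nat) (a b s : int) v :
  (m %| a ^+ 2 + b ^+ 2 + 1)%Z -> quat_lattice m a b s v -> (m %| norm4 v)%Z.
Proof.
case: v => [[[x y] z] w] /dvdzP[c Hc] /andP[/dvdzP[p Hp] /dvdzP[q Hq]].
apply/dvdzP.
exists ((x + a * z + b * w) * q - (- y + b * z - a * w) * p + c * (z ^+ 2 + w ^+ 2)).
transitivity ((x + a * z + b * w) * (q * m) - (- y + b * z - a * w) * (p * m)
  + (c * m) * (z ^+ 2 + w ^+ 2)); last ring.
by rewrite -Hp -Hq -Hc /=; ring.
Qed.

(** If v lies in both lattices, then (s - s') v vanishes mod m. With g = gcd(m, s - s') and m = m'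
    g, v is m' times a vector of the lattice mod g, so its norm is m' h m for some h. Then m' is odd
    and divides 4, whence m' = 1 and g = m. *)
Lemma quat_lattice_inj (m : nat) (a b s s' : int) v :
  odd m -> (m %| a ^+ 2 + b ^+ 2 + 1)%Z ->
  norm4 v = 2 * m%:Z \/ norm4 v = 4 * m%:Z ->
  quat_lattice m a b s v -> quat_lattice m a b s' v -> (m %| s - s')%Z.
Proof.
case: v => [[[x y] z] w] om mab Hj Ls Ls'.
have m_gt0 : (0 < m)%N by case: (m) om.
have co2 : coprimez m 2 by rewrite coprimezE /= coprime_sym prime_coprime // dvdn2 negbK.
set dl := s - s'.
have /andP[/dvdzP[p Hp] /dvdzP[q Hq]] := Ls.
have /andP[/dvdzP[p' Hp'] /dvdzP[q' Hq']] := Ls'.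
have /dvdzP[c Hc] := mab.
(* Subtracting the two memberships shows that [dl] annihilates the first column mod m; the
   membership for s then gives the same for the second column. *)
have dP : dl * (x + a * z + b * w) = (p - p') * m by rewrite [RHS]mulrBl -Hp -Hp' /dl; ring.
have dR : dl * (- y + b * z - a * w) = (q - q') * m by rewrite [RHS]mulrBl -Hq -Hq' /dl; ring.
have dQ : dl * (y + b * z - a * w) = (dl * p - s * (p - p')) * m.
  transitivity (dl * (p * m) - s * ((p - p') * m)); last ring.
  by rewrite -Hp -dP; ring.
have dT : dl * (x - a * z - b * w) = (dl * q - s * (q - q')) * m.
  transitivity (dl * (q * m) - s * ((q - q') * m)); last ring.
  by rewrite -Hq -dR; ring.
set e1 := dl * q - s * (q - q') in dT *; set e2 := dl * p - s * (p - p') in dQ *.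
(* 2 x and 2 y are a sum and a difference of entries, and 2 is invertible mod m; z and w are
   recovered likewise, using a^2 + b^2 = -1. *)
have dx : (m %| dl * x)%Z.
  rewrite -(Gauss_dvdzr _ co2); apply/dvdzP.
  by exists ((p - p') + e1); rewrite [RHS]mulrDl -dP -dT; ring.
have dy : (m %| dl * y)%Z.
  rewrite -(Gauss_dvdzr _ co2); apply/dvdzP.
  by exists (e2 - (q - q')); rewrite [RHS]mulrBl -dQ -dR; ring.
have dz : (m %| dl * z)%Z.
  rewrite -(Gauss_dvdzr _ co2); apply/dvdzP.
  exists (2 * dl * z * c - a * ((p - p') - e1)
     - b * (e2 + (q - q'))).
  transitivity (2 * dl * z * (c * m) - a * ((p - p') * m - e1 * m) - b * (e2 * m + (q - q') * m)); last ring.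
  by rewrite -dP -dT -dQ -dR -Hc; ring.
have dw : (m %| dl * w)%Z.
  rewrite -(Gauss_dvdzr _ co2); apply/dvdzP.
  exists (2 * dl * w * c - b * ((p - p') - e1)
     + a * (e2 + (q - q'))).
  transitivity (2 * dl * w * (c * m) - b * ((p - p') * m - e1 * m) + a * (e2 * m + (q - q') * m)); last ring.
  by rewrite -dP -dT -dQ -dR -Hc; ring.
pose g := gcdn m `|dl|%N.
have g_gt0 : (0 < g)%N by rewrite gcdn_gt0 m_gt0.
have /dvdnP[m' mE] : (g %| m)%N by exact: dvdn_gcdl.
have /dvdzP[dl' dlE] : (g %| dl)%Z by rewrite dvdzE; exact: dvdn_gcdr.
have com' : coprimez m' dl'.
  rewrite coprimezE /= /coprime -(eqn_pmul2r g_gt0) mul1n muln_gcdl -mE.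
  by have -> : (`|dl'| * g)%N = `|dl|%N by rewrite dlE abszM.
have dvdm' t : (m %| dl * t)%Z -> exists t', t = m'%:Z * t'.
  rewrite mE dlE PoszM mulrAC dvdz_mul2r ?Gauss_dvdzr //; last by lia.
  by case/dvdzP => t' ->; exists t'; rewrite mulrC.
have [x' xE] := dvdm' _ dx; have [y' yE] := dvdm' _ dy.
have [z' zE] := dvdm' _ dz; have [w' wE] := dvdm' _ dw.
have m'_gt0 : (0 < m')%N by case: (m') mE m_gt0 => // ->.
have Lg : quat_lattice g a b s (x', y', z', w').
  have m'0 : m'%:Z != 0 by lia.
  move: Ls; rewrite /quat_lattice xE yE zE wE => /andP[H1 H2].
  apply/andP; split; rewrite -(dvdz_mul2l m'0) -PoszM -mE; [move: H1|move: H2];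
    congr (_ %| _)%Z; ring.
have gab : (g %| a ^+ 2 + b ^+ 2 + 1)%Z.
  by apply: dvdz_trans mab; rewrite dvdzE; exact: dvdn_gcdl.
have /dvdzP[h Hh] := quat_lattice_norm gab Lg.
have nE : norm4 (x, y, z, w) = m'%:Z * h * m%:Z.
  rewrite mE PoszM (_ : _ * _ * _ = m'%:Z ^+ 2 * (h * g)); last ring.
  by rewrite -Hh /= xE yE zE wE; ring.
have om' : odd m' by move: om; rewrite mE oddM => /andP[].
have : m'%:Z * h = 2 \/ m'%:Z * h = 4.
  have m0 : m%:Z != 0 by lia.
  by move: Hj; rewrite nE => -[] /(mulIf m0); auto.
move=> H; have m'1 : m' = 1%N.
  have : (m' <= 4)%N.
    apply: dvdn_leq => //; have : (m' %| 4)%Z; last by rewrite dvdzE.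
    case: H => H; apply/dvdzP; [exists (2 * h)|exists h]; last by rewrite mulrC H.
    by rewrite -mulrA (mulrC h) H.
  by case: (m') (h) om' H => [|[|[|[|[|?]]]]] h' //; clear=> _ []; lia.
by rewrite mE m'1 mul1n dlE dvdz_mull.
Qed.

(* Adding the parity of x + y + z + w to the pigeonholes makes the norm an even
   multiple of m below 6 m. *)
Lemma quat_lattice_short (m : nat) (a b s : int) : odd m ->
  (m %| a ^+ 2 + b ^+ 2 + 1)%Z ->
  exists2 v, quat_lattice m a b s v &
    norm4 v = 2 * m%:Z \/ norm4 v = 4 * m%:Z.
Proof.
move=> om mab; have m_gt0 : (0 < m)%N by case: (m) om.
(* k is the integer part of (2 m^2)^(1/4): the (k + 1)^4 vectors with coordinates in 0, ..., k
   outnumber the 2 m^2 pigeonholes. *)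
have exk : exists k, (k ^ 4 <= 2 * m ^ 2)%N by exists 0%N.
have bk k : (k ^ 4 <= 2 * m ^ 2)%N -> (k <= 2 * m ^ 2)%N.
  by apply: leq_trans; rewrite -{1}[k]expn1; case: k => // k; rewrite leq_pexp2l.
case: (ex_maxnP exk bk) => k kle kmax.
have kgt : (2 * m ^ 2 < k.+1 ^ 4)%N.
  by rewrite ltnNge; apply/negP => /kmax; rewrite ltnn.
pose I := 'I_k.+1.
pose c1 (x y z w : int) := s * (x + a * z + b * w) + (y + b * z - a * w).
pose c2 (x y z w : int) := s * (- y + b * z - a * w) + (x - a * z - b * w).
pose res (t : int) : 'I_m := Ordinal (ltn_pmod `|(t %% m)%Z|%N m_gt0).
have resP t t' : res t = res t' -> (m %| t - t')%Z.
  move=> /(congr1 (fun i : 'I_m => (i : nat)%:Z)) /=.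
  have small u : (`|(u %% m)%Z| < m)%N.
    by have := ltz_pmod u (d := m); have := @modz_ge0 u m; lia.
  rewrite !modn_small // !gez0_abs ?modz_ge0 //; try by lia.
  by move=> /eqP; rewrite eqz_mod_dvd.
pose f (t : I * I * I * I) : 'I_m * 'I_m * bool :=
  let: (x, y, z, w) := t in
  (res (c1 x%:Z y%:Z z%:Z w%:Z), res (c2 x%:Z y%:Z z%:Z w%:Z), odd (x + y + z + w)).
have : ~~ injectiveb f.
  apply/negP => /injectiveP /leq_card.
  by rewrite !card_prod !card_ord card_bool; apply/negP; rewrite -ltnNge; lia.
case/injectivePn => -[[[x y] z] w] [[[[x' y'] z'] w'] ne] E.
have E1 := resP _ _ (congr1 (fun t => t.1.1) E).
have E2 := resP _ _ (congr1 (fun t => t.1.2) E).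
have E3 : odd (x + y + z + w) = odd (x' + y' + z' + w') := congr1 snd E.
pose v : int * int * int * int :=
  (x%:Z - x'%:Z, y%:Z - y'%:Z, z%:Z - z'%:Z, w%:Z - w'%:Z).
have Lv : quat_lattice m a b s v.
  apply/andP; split; [move: E1|move: E2];
    congr (_ %| _)%Z; rewrite /c1 /c2; ring.
exists v => //.
have /dvdzP[j Hj] := quat_lattice_norm mab Lv.
have sq_le (t t' : I) : 0 <= (t%:Z - t'%:Z) ^+ 2 <= (k ^ 2)%N%:Z.
  have := ltn_ord t; have := ltn_ord t'; clear; nia.
have nle : norm4 v <= 4 * (k ^ 2)%N%:Z.
  move: (sq_le x x') (sq_le y y') (sq_le z z') (sq_le w w').
  by rewrite /norm4 /v; clear; lia.
have npos : 0 < norm4 v.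
  rewrite lt_neqAle; apply/andP; split; last first.
    move: (sq_le x x') (sq_le y y') (sq_le z z') (sq_le w w').
    by rewrite /norm4 /v; clear; lia.
  apply/negP => /eqP /esym n0; case/negP: ne; apply/eqP.
  have e0 (t t' : I) : (t%:Z - t'%:Z) ^+ 2 = 0 -> t = t'.
    by move=> /eqP; rewrite sqrf_eq0 subr_eq0 => /eqP[] /val_inj.
  have sum0 (p q r t : int) : p + q + r + t = 0 -> 0 <= p -> 0 <= q -> 0 <= r ->
      0 <= t -> [/\ p = 0, q = 0, r = 0 & t = 0] by clear => *; split; lia.
  have [] := sum0 _ _ _ _ n0 (sqr_ge0 _) (sqr_ge0 _) (sqr_ge0 _) (sqr_ge0 _).
  by move=> /e0-> /e0-> /e0-> /e0->.
(* A square has the parity of its root, and the pigeonholes make the coordinate sum of v even. *)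
have neven : (2 %| norm4 v)%Z.
  have sq2 (t : int) : exists q, t ^+ 2 = t + 2 * q.
    have := divz_eq t 2; have := @modz_ge0 t 2; have := ltz_pmod t (d := 2).
    set q := (t %/ 2)%Z; set r := (t %% 2)%Z => r2 r0 tE.
    have [r0'|r1] : r = 0 \/ r = 1 by lia.
      by exists (2 * q ^+ 2 - q); rewrite tE r0'; ring.
    by exists (2 * q ^+ 2 + q); rewrite tE r1; ring.
  have [p1 H1] := sq2 (x%:Z - x'%:Z); have [p2 H2] := sq2 (y%:Z - y'%:Z).
  have [p3 H3] := sq2 (z%:Z - z'%:Z); have [p4 H4] := sq2 (w%:Z - w'%:Z).
  have [c Hc] : exists c : int, (x + y + z + w)%N%:Z - (x' + y' + z' + w')%N%:Z = 2 * c.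
    exists ((x + y + z + w)./2%:Z - (x' + y' + z' + w')./2%:Z).
    have := odd_double_half (x + y + z + w); have := odd_double_half (x' + y' + z' + w').
    by rewrite E3; clear; lia.
  apply/dvdzP; exists (c + p1 + p2 + p3 + p4); rewrite /norm4 /v H1 H2 H3 H4.
  by move: Hc; clear; lia.
have jge : 0 < j.
  by move: npos; rewrite Hj pmulr_lgt0 // ltz_nat.
(* The norm is at most 4 k^2 <= 4 sqrt(2) m < 6 m; squared, 36 m^2 <= 16 k^4 <= 32 m^2 is absurd. *)
have jlt : j < 6.
  have H4 : j * m <= 4 * (k ^ 2)%N%:Z by rewrite -Hj.
  have H5 : ((k ^ 2) * (k ^ 2) <= 2 * (m * m))%N by rewrite -expnD mulnn.
  rewrite ltNge; apply/negP => j6.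
  have H6 : (6 * m <= 4 * k ^ 2)%N.
    by move: H4 j6; clear; nia.
  have := m_gt0; have := leq_mul H6 H6; move: H5; clear; nia.
have j2 : (2 %| j)%Z.
  rewrite -(Gauss_dvdzl (p := m) j) -?Hj //.
  by rewrite coprimezE /= prime_coprime // dvdn2 negbK.
move: jge jlt j2 Hj; case: j => // -[|[|[|[|[|[|j]]]]]] // _ _ _ ->; by auto.
Qed.

(** The map doubles norms; it is its inverse that halves them. The index i selects which coordinate
    is paired with the first, each pair being written as a sum and a difference. *)
Definition halving (i : 'I_3) (v : int * int * int * int) : int * int * int * int :=
  let: (x, y, z, w) := v in
  match val i with
  | 0 => (x + y, x - y, z + w, z - w)
  | 1 => (x + y, z + w, x - y, z - w)
  | _ => (x + y, z + w, z - w, x - y)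
  end.

Lemma norm4_halving i v : norm4 (halving i v) = 2 * norm4 v.
Proof. by case: v i => [[[x y] z] w] [[|[|i]] ?]; rewrite /norm4 /=; ring. Qed.

(** An even norm has an even number of odd coordinates, so the four coordinates split into two pairs
    of equal parity, in one of three ways. *)
Lemma norm4_even v : (2 %| norm4 v)%Z -> exists i u, v = halving i u.
Proof.
case: v => [[[x y] z] w] /dvdzP[c Hc].
have sq2 (t : int) : exists q r, (t = 2 * q + r /\ (r = 0 \/ r = 1)) /\
    exists q', t ^+ 2 = r + 2 * q'.
  have := divz_eq t 2; have := @modz_ge0 t 2; have := ltz_pmod t (d := 2).
  set q := (t %/ 2)%Z; set r := (t %% 2)%Z => r2 r0 tE.
  exists q, r; have r01 : r = 0 \/ r = 1 by lia.
  split; first by split => //; lia.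
  exists (2 * q ^+ 2 + 2 * q * r).
  by rewrite tE; case: r01 => ->; ring.
have [x1 [x0 [[xE Hx] [x2 X]]]] := sq2 x.
have [y1 [y0 [[yE Hy] [y2 Y]]]] := sq2 y.
have [z1 [z0 [[zE Hz] [z2 Z]]]] := sq2 z.
have [w1 [w0 [[wE Hw] [w2 W]]]] := sq2 w.
have e : x0 + y0 + z0 + w0 = 2 * (c - x2 - y2 - z2 - w2).
  by move: Hc; rewrite /norm4 X Y Z W; clear; lia.
have [[xy zw]|[[xz yw]|[xw yz]]] :
    (x0 = y0 /\ z0 = w0) \/ (x0 = z0 /\ y0 = w0) \/ (x0 = w0 /\ y0 = z0).
  by move: Hx Hy Hz Hw e; clear; lia.
- exists 0, (x1 + y1 + x0, x1 - y1, z1 + w1 + z0, z1 - w1).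
  by rewrite xE yE zE wE /=; congr (_, _, _, _); lia.
- exists 1, (x1 + z1 + x0, x1 - z1, y1 + w1 + y0, y1 - w1).
  by rewrite xE yE zE wE /=; congr (_, _, _, _); lia.
- exists 2, (x1 + w1 + x0, x1 - w1, y1 + z1 + y0, y1 - z1).
  by rewrite xE yE zE wE /=; congr (_, _, _, _); lia.
Qed.

(** A short vector of norm 2 m is halved once, one of norm 4 m twice. The first pairing, the
    optional second one and the resulting vector of norm m determine s, and there are 3 (1 + 3) = 12
    choices of pairings. *)
Lemma four_squares_count (m : nat) : odd m ->
  exists s : seq (int * int * int * int),
    [/\ uniq s, {in s, forall v, norm4 v = m} & (m <= 12 * size s)%N].
Proof.
move=> om; have m_gt0 : (0 < m)%N by case: (m) om.
have [a [b mab]] := dvdz_sum_two_squares_succ om.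
pose F (p : 'I_3 * option 'I_3 * (int * int * int * int)) :=
  let: (i, o, v) := p in halving i (if o is Some j then halving j v else v).
have ex (s : 'I_m) : exists p, [/\ norm4 p.2 = m,
    quat_lattice m a b s (F p) & norm4 (F p) = 2 * m%:Z \/ norm4 (F p) = 4 * m%:Z].
  have [v Lv nv] := quat_lattice_short s%:Z om mab.
  have [i [u uE]] : exists i u, v = halving i u.
    by apply: norm4_even; case: nv => ->; rewrite dvdz_mulr.
  case: (nv); rewrite uE norm4_halving => H.
    by exists (i, None, u); split => /=; rewrite -?uE //; lia.
  have [j [w wE]] : exists j w, u = halving j w.
    by apply: norm4_even; apply/dvdzP; exists m%:Z; lia.
  exists (i, Some j, w); split => /=; rewrite -?wE -?uE //.
  by move: H; rewrite wE norm4_halving; lia.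
have [G HG] := choice ex.
have Ginj : injective G.
  move=> s t E; have [_ Ls nv] := HG s; have [_ Lt _] := HG t.
  rewrite -E in Lt; have := quat_lattice_inj om mab nv Ls Lt.
  rewrite -eqz_mod_dvd !modz_small ?ltz_nat ?ltn_ord // => /eqP[].
  exact: val_inj.
pose T := [seq (G s).2 | s : 'I_m].
(* Different s may give the same vector of norm m, with different pairings; hence the removal of
   duplicates. *)
exists (undup T); split; first exact: undup_uniq.
  by move=> v; rewrite mem_undup => /mapP[s _ ->]; have [] := HG s.
have -> : (12 = #|{: 'I_3 * option 'I_3}|)%N by rewrite card_prod card_option !card_ord.
rewrite cardE -(size_allpairs pair) -[X in (X <= _)%N]card_ord cardE -(size_map G).
apply: uniq_leq_size; first by rewrite map_inj_uniq ?enum_uniq.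
move=> p /mapP[s _ ->]; apply/allpairsP; exists ((G s).1, (G s).2); split => //=.
- by rewrite mem_enum.
- by rewrite mem_undup; apply/mapP; exists s; rewrite ?mem_enum.
- by case: (G s).
Qed.

(** * Spheres in dimension at least five *)

(** The last e coordinates range over a box with Y^e points, whose size leaves an odd remainder of
    at least n / 2 for the first four; the four-square count then gives n / 24 points over each. *)
Lemma sphere_points (e n : nat) : (0 < e)%N -> (0 < n)%N ->
  exists (s : seq 'rV[int]_(4 + e)) (Y : nat),
    [/\ uniq s, forall v, v \in s -> \sum_i v ord0 i ^+ 2 = n%:Z,
        (n <= (6 * e * Y) ^ 2)%N, (Y ^ e * n <= 24 * size s)%N & (2 <= size s)%N].
Proof.
move=> e_gt0 n_gt0; case: e e_gt0 => // e _.
(* Y is the largest integer with 8 e Y^2 <= n, or 1 if n is too small for that; in the latter case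
   the box is a single point. Maximality gives n < 8 e (2 Y)^2. *)
have [Y [Y_gt0 Yn nY]] : exists Y, [/\ (0 < Y)%N,
    Y = 1%N \/ (8 * e.+1 * Y ^ 2 <= n)%N & (n <= (6 * e.+1 * Y) ^ 2)%N].
  have [n_ge|n_lt] := leqP (8 * e.+1) n; last first.
    by exists 1%N; split; auto; rewrite muln1; clear -n_lt; nia.
  have ex : exists Y, (8 * e.+1 * Y ^ 2 <= n)%N by exists 1%N; rewrite muln1.
  have bd Y : (8 * e.+1 * Y ^ 2 <= n)%N -> (Y <= n)%N by clear; nia.
  case: (ex_maxnP ex bd) => Y HY maxY; exists Y.
  have Y_gt0 : (0 < Y)%N by apply: maxY; rewrite muln1.
  split; auto.
  have : (n < 8 * e.+1 * Y.+1 ^ 2)%N.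
    by rewrite ltnNge; apply/negP => /maxY; rewrite ltnn.
  have : (Y.+1 <= 2 * Y)%N by lia.
  clear; move=> H H'; apply: (leq_trans (ltnW H')).
  have : (8 * e.+1 * (2 * Y) ^ 2 <= (6 * e.+1 * Y) ^ 2)%N.
    by rewrite -!mulnn; nia.
  by apply: leq_trans; rewrite leq_mul2l leq_sqr H orbT.
pose eps : nat := ~~ odd n.
(* The shift of the first coordinate makes [n - N y] odd. *)
pose x (y : {ffun 'I_e.+1 -> 'I_Y}) (i : 'I_e.+1) : nat := (2 * y i + (i == ord0) * eps)%N.
pose N y := (\sum_i x y i ^ 2)%N.
have x_lt y i : (x y i <= 2 * Y)%N.
  rewrite /x; have := ltn_ord (y i); have : (eps <= 1)%N by rewrite /eps; case: odd.
  by case: (i == ord0); clear; lia.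
have N_le y : (2 * N y <= n)%N.
  case: Yn => [Y1|HY].
    suff -> : N y = eps by rewrite /eps; case: (n) n_gt0 => [|[|k]] //= _; lia.
    rewrite /N big_ord_recl big1 ?addn0 => [|i _]; rewrite /x.
      have -> : (y ord0 : nat) = 0%N by have := ltn_ord (y ord0); lia.
      by rewrite /eps; case: odd.
    by have -> : (y (lift ord0 i) : nat) = 0%N by have := ltn_ord (y (lift ord0 i)); lia.
  have : (N y <= \sum_(i < e.+1) (2 * Y) ^ 2)%N by apply: leq_sum => i _; rewrite leq_sqr.
  rewrite sum_nat_const card_ord; move: HY; clear; lia.
have N_odd y : odd (n - N y).
  rewrite oddB; last by have := N_le y; lia.
  rewrite /N big_ord_recl oddD oddX /= /x eqxx mul1n oddD oddM /=.
  have -> : odd (\sum_(i < e) x y (lift ord0 i) ^ 2) = false.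
    apply/negbTE; rewrite -dvdn2; apply: dvdn_sum => i _.
    by rewrite /x /= mul0n addn0 expnMn -mulnA dvdn_mulr.
  by rewrite addbF /eps; case: (odd n).
have ex (m : nat) : exists s : seq (int * int * int * int), odd m ->
    [/\ uniq s, {in s, forall v, norm4 v = m} & (m <= 12 * size s)%N].
  have [om|_] := boolP (odd m); last by exists [::].
  by have [s ?] := four_squares_count om; exists s.
have [S HS] := choice ex.
pose q4 (v : int * int * int * int) : 'rV[int]_4 :=
  let: (a, b, c, d) := v in \row_i nth 0 [:: a; b; c; d] i.
have q4_inj : injective q4.
  move=> [[[a b] c] d] [[[a' b'] c'] d'] /rowP H.
  by move: (H 0) (H 1) (H 2) (H 3); rewrite !mxE /= => -> -> -> ->.
pose mk y v : 'rV[int]_(4 + e.+1) := row_mx (q4 v) (\row_i (x y i)%:Z).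
have mk_inj y v y' v' : mk y v = mk y' v' -> y = y' /\ v = v'.
  case/eq_row_mx => /q4_inj -> /rowP H; split => //; apply/ffunP => i; apply: val_inj.
  by have := H i; rewrite !mxE /x => -[] /eqP; rewrite eqn_add2r eqn_mul2l => /eqP.
pose s0 := [seq mk y v | y <- enum {ffun 'I_e.+1 -> 'I_Y}, v <- S (n - N y)%N].
have s0_norm v : v \in s0 -> \sum_i v ord0 i ^+ 2 = n%:Z.
  case/allpairsPdep => y [u [_ uS ->]].
  have [_ /(_ _ uS) nu _] := HS _ (N_odd y).
  rewrite big_split_ord /=.
  under eq_bigr do rewrite row_mxEl.
  under [X in _ + X]eq_bigr do rewrite row_mxEr mxE.
  have -> : \sum_(i < 4) q4 u ord0 i ^+ 2 = norm4 u.
    case: u {uS nu} => [[[a b] c] d].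
    by rewrite !big_ord_recl big_ord0 !mxE /=; ring.
  rewrite nu; transitivity ((n - N y)%N%:Z + (N y)%:Z).
    by congr (_ + _); rewrite /N; elim/big_rec2: _ => // i a b _ ->; rewrite PoszD -mulnn PoszM expr2.
  by rewrite -PoszD subnK //; have := N_le y; clear; lia.
have s0_uniq : uniq s0.
  apply: allpairs_uniq_dep; first exact: enum_uniq.
    by move=> y _; have [] := HS _ (N_odd y).
  by move=> [y u] [y' u'] _ _ /mk_inj[/= <- <-].
have s0_size : (Y ^ e.+1 * n <= 24 * size s0)%N.
  rewrite size_allpairs_dep.
  have -> : (Y ^ e.+1 = size (enum {ffun 'I_e.+1 -> 'I_Y}))%N.
    by rewrite -cardE card_ffun !card_ord.
  elim: (enum _) => //= y l IHl.
  have [_ _ H] := HS _ (N_odd y); have := N_le y; lia.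
(* Adding the opposite points ensures at least two points even for small n. *)
exists (undup (s0 ++ map -%R s0)), Y; split => //; first exact: undup_uniq.
- move=> v; rewrite mem_undup mem_cat => /orP[/s0_norm//|/mapP[u /s0_norm <- ->]].
  by apply: eq_bigr => i _; rewrite mxE sqrrN.
- apply: (leq_trans s0_size); rewrite leq_mul2l /=; apply: uniq_leq_size => // v vs.
  by rewrite mem_undup mem_cat vs.
- have : (0 < size s0)%N.
    have : (0 < Y ^ e.+1 * n)%N by rewrite muln_gt0 expn_gt0 Y_gt0.
    by move: s0_size; clear; lia.
  case: s0 s0_norm {s0_uniq s0_size} => // v s nv _.
  have : (size [:: v; - v] <= size (undup ((v :: s) ++ map -%R (v :: s))))%N.
    apply: uniq_leq_size; last first.
      move=> u; rewrite !inE mem_undup mem_cat => /orP[] /eqP ->.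
        by rewrite mem_head.
      by rewrite /= mem_head orbT.
    rewrite /= inE andbT; apply/negP => /eqP vN.
    have := nv v (mem_head _ _); rewrite big1 => [H|i _]; first by move: n_gt0; rewrite -ltz_nat -H.
    have /matrixP/(_ ord0 i) := vN; rewrite !mxE => H.
    by move/eqP: H; rewrite -subr_eq0 opprK -mulr2n mulrn_eq0 /= => /eqP ->.
  by [].
Qed.

(** * Functions on the sphere with vanishing moments *)

Definition dot (R : pzRingType) (d : nat) (k : 'rV[int]_d) (x : 'rV[R]_d) : R :=
  \sum_i (k ord0 i)%:~R * x ord0 i.

(** Only monomials with exponent 0 or 1 in the first coordinate and exponents below M in the others
    impose conditions. The factor [minn 2 M] makes this a single condition when M = 1, so that two
    points suffice then. *)
Lemma exists_vanishing_moments (F : fieldType) (D N M : nat) (n : int)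
    (K : 'I_N -> 'rV[int]_D.+1) :
  (forall l, \sum_i K l ord0 i ^+ 2 = n) -> (minn 2 M * M ^ D < N)%N ->
  exists2 a : 'rV[F]_N, a != 0 &
    forall j x, (j < M)%N -> \sum_l a ord0 l * dot (K l) x ^+ j = 0.
Proof.
move=> normK ltN.
pose T : finType := ({ffun 'I_D -> 'I_M} * 'I_(minn 2 M))%type.
pose k l i : F := (K l ord0 i)%:~R.
pose mon (b : 'I_D -> nat) l := \prod_i k l (lift ord0 i) ^+ b i.
pose A : 'M[F]_(N, #|T|) :=
  \matrix_(l, c) (mon (fun i => (enum_val c : T).1 i) l * k l ord0 ^+ (enum_val c : T).2).
have kerA : kermx A != 0.
  rewrite kermx_eq0 /row_free; apply/negP => /eqP rA.
  have := rank_leq_col A; rewrite rA; apply/negP; rewrite -ltnNge.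
  by rewrite card_prod card_ffun !card_ord mulnC.
have /rowV0Pn[a /sub_kermxP aA a0] := kerA.
exists a => //.
(* Exponents [e >= 2] of the first coordinate are lowered with
   [k_0 ^+ 2 = n - \sum_i k_i ^+ 2]. *)
have low e (b : 'I_D -> nat) : (\sum_i b i + e < M)%N ->
    \sum_l a ord0 l * (mon b l * k l ord0 ^+ e) = 0.
  elim/ltn_ind: e b => e IHe b ltM.
  have [e2|e2] := ltnP e 2.
    have bM i : (b i < M)%N.
      by apply: leq_ltn_trans ltM; rewrite (bigD1 i) //= -addnA leq_addr.
    have eM : (e < minn 2 M)%N by rewrite leq_min e2 (leq_ltn_trans _ ltM) ?leq_addl.
    pose c : T := ([ffun i => Ordinal (bM i)], Ordinal eM).
    have /rowP/(_ (enum_rank c)) := aA; rewrite !mxE => H; rewrite -[RHS]H.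
    apply: eq_bigr => l _; rewrite mxE enum_rankK /=; congr (_ * (_ * _)).
    by apply: eq_bigr => i _; rewrite ffunE.
  case: e e2 ltM IHe => [|[|e]] // _ ltM IHe.
  have k2 l : k l ord0 ^+ 2 = n%:~R - \sum_i k l (lift ord0 i) ^+ 2.
    rewrite -(normK l) big_ord_recl rmorphD /= rmorphXn /= rmorph_sum /=.
    by under [in RHS]eq_bigr do rewrite rmorphXn /=; rewrite addrK.
  pose b' i j := (b j + 2 * (j == i))%N.
  have mb' i l : mon (b' i) l = mon b l * k l (lift ord0 i) ^+ 2.
    rewrite /mon -[k l (lift ord0 i) ^+ 2]mulr1.
    under eq_bigr do rewrite exprD.
    rewrite big_split /= [X in _ * X](bigD1 i) //= eqxx muln1.
    by rewrite [X in _ * (_ * X)]big1 // => j /negbTE ->; rewrite muln0.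
  transitivity (n%:~R * (\sum_l a ord0 l * (mon b l * k l ord0 ^+ e)) -
      \sum_i \sum_l a ord0 l * (mon (b' i) l * k l ord0 ^+ e)).
    rewrite exchange_big mulr_sumr -sumrB; apply: eq_bigr => l _ /=.
    rewrite -mulr_sumr -mulr_suml.
    under eq_bigr do rewrite mb'.
    by rewrite -mulr_sumr -addn2 exprD k2; ring.
  rewrite IHe //; last by lia.
  rewrite mulr0 big1 ?subr0 // => i _; apply: IHe => //.
  rewrite /b' big_split /= -big_distrr /= [X in (_ + 2 * X + _ < _)%N](bigD1 i) //= eqxx.
  by rewrite [X in (_ + 2 * (_ + X) + _ < _)%N]big1 => [|j /negbTE -> //]; rewrite -addnA.
(* The powers of [dot (K l) x] are expanded one factor at a time, each factor raising the degree of
   the monomial by one. *)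
have high j e (b : 'I_D -> nat) x : (\sum_i b i + e + j < M)%N ->
    \sum_l a ord0 l * (mon b l * k l ord0 ^+ e * dot (K l) x ^+ j) = 0.
  elim: j e b => [|j IHj] e b ltM.
    under eq_bigr do rewrite expr0 mulr1.
    by apply: low; lia.
  pose b' i j := (b j + (j == i))%N.
  have mb' i l : mon (b' i) l = mon b l * k l (lift ord0 i).
    rewrite /mon -[k l (lift ord0 i)]mulr1.
    under eq_bigr do rewrite exprD.
    rewrite big_split /= [X in _ * X](bigD1 i) //= eqxx expr1.
    by rewrite [X in _ * (_ * X)]big1 // => h /negbTE ->.
  transitivity (x ord0 ord0 * (\sum_l a ord0 l * (mon b l * k l ord0 ^+ e.+1 * dot (K l) x ^+ j)) +
      \sum_i x ord0 (lift ord0 i) *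
       \sum_l a ord0 l * (mon (b' i) l * k l ord0 ^+ e * dot (K l) x ^+ j)).
    under [X in _ = _ + X]eq_bigr do rewrite mulr_sumr.
    rewrite exchange_big mulr_sumr -big_split; apply: eq_bigr => l _ /=.
    under eq_bigr do rewrite mb'.
    have dotE : dot (K l) x = k l ord0 * x ord0 ord0 +
        \sum_i k l (lift ord0 i) * x ord0 (lift ord0 i) by rewrite /dot big_ord_recl.
    rewrite (_ : \sum_i _ = a ord0 l * mon b l * k l ord0 ^+ e * dot (K l) x ^+ j *
       (\sum_i k l (lift ord0 i) * x ord0 (lift ord0 i))).
      by rewrite !exprS [X in X * _ ^+ j]dotE; ring.
    by rewrite mulr_sumr; apply: eq_bigr => i _; ring.
  rewrite IHj ?mulr0 ?add0r; last by lia.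
  rewrite big1 // => i _; rewrite IHj ?mulr0 //.
  rewrite /b' big_split /= [X in (_ + X + _ + _ < _)%N](bigD1 i) //= eqxx.
  by rewrite [X in (_ + (_ + X) + _ + _ < _)%N]big1 => [|h /negbTE -> //]; rewrite addn0 addn1 !addSn; move: ltM; rewrite addnS.
move=> j x jM; rewrite -[RHS](high j 0 (fun=> 0%N) x); last by rewrite big1.
by apply: eq_bigr => l _; rewrite /mon big1 ?mul1r ?mulr1 ?mul1r.
Qed.

(** * Trigonometric polynomials *)

(** Taylor's estimate at 0 for a function whose successive derivatives are [h 1], [h 2], and so on.
    The bound on [h 1] given by induction makes B x^(M+1) / (M+1)! - s h_0(x) nondecreasing for s =
    1 and s = -1. *)
Lemma derive_tower_bound (R : realType) (h : nat -> R -> R) (B : R) (M : nat) :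
  (forall j x, is_derive x (1 : R) (h j) (h j.+1 x)) ->
  (forall j, (j < M)%N -> h j 0 = 0) ->
  (forall y, 0 <= y <= 1 -> `|h M y| <= B) ->
  forall y, 0 <= y <= 1 -> `|h 0%N y| <= B * y ^+ M / M`!%:R.
Proof.
elim: M h => [|M IHM] h dh h0 hB y y01.
  by rewrite expr0 mulr1 fact0 divr1 hB.
have IH x : 0 <= x <= 1 -> `|h 1%N x| <= B * x ^+ M / M`!%:R.
  apply: (IHM (fun j => h j.+1)) => //.
  by move=> j jM; apply: h0.
have sgn_bound (s : R) : `|s| = 1 -> s * h 0%N y <= B * y ^+ M.+1 / M.+1`!%:R.
  move=> s1; rewrite -subr_ge0.
  pose g : R -> R := fun x => B / M.+1`!%:R * x ^+ M.+1 - s * h 0%N x.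
  have dg x : is_derive x (1 : R) g (B * x ^+ M / M`!%:R - s * h 1%N x).
    have -> : g = (B / M.+1`!%:R) \*: ((@id R : R -> R) ^+ M.+1) - s \*: h 0%N.
      by apply/funext => z; rewrite /g !fctE.
    have H := is_deriveB (is_deriveZ (B / M.+1`!%:R) (is_deriveX M.+1 (is_derive_id x (1 : R))))
      (is_deriveZ s (dh 0%N x)).
    apply: is_derive_eq H _; rewrite /= /GRing.scale /= mulr1.
    rewrite factS natrM; congr (_ - _).
    have f0 : M`!%:R != 0 :> R by rewrite pnatr_eq0 -lt0n fact_gt0.
    by field; rewrite f0 nat1r pnatr_eq0.
  have -> : B * y ^+ M.+1 / M.+1`!%:R - s * h 0%N y = g y.
    by rewrite /g mulrAC.
  have <- : g 0 = 0 by rewrite /g h0 // expr0n /= !mulr0 subr0.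
  have /andP[y0 y1] := y01.
  apply: (@ger0_derive1_ndecr R g 0 1) => // [x xI|].
  - rewrite derive1E; have [_ ->] := dg x; rewrite subr_ge0.
    have x01 : 0 <= x <= 1 by move: xI; rewrite in_itv /= => /andP[/ltW -> /ltW].
    apply: le_trans (IH x x01); rewrite -[X in _ <= X]mul1r -s1 -normrM.
    exact: ler_norm.
  - apply: continuous_subspaceT => x; apply: differentiable_continuous.
    by apply/derivable1_diffP; have [] := dg x.
rewrite ler_norml; apply/andP; split.
  by rewrite lerNl -mulN1r; apply: sgn_bound; rewrite normrN1.
by rewrite -[X in X <= _]mul1r; apply: sgn_bound; rewrite normr1.
Qed.

Lemma dotDr (R : pzRingType) d (k : 'rV[int]_d) (x y : 'rV[R]_d) :
  dot k (x + y) = dot k x + dot k y.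
Proof. by rewrite /dot -big_split; apply: eq_bigr => i _; rewrite mxE mulrDr. Qed.

Lemma dotZr (R : comPzRingType) d (k : 'rV[int]_d) (c : R) (x : 'rV[R]_d) :
  dot k (c *: x) = c * dot k x.
Proof. by rewrite /dot mulr_sumr; apply: eq_bigr => i _; rewrite mxE mulrCA. Qed.

Lemma dotDl (R : pzRingType) d (k l : 'rV[int]_d) (x : 'rV[R]_d) :
  dot (k + l) x = dot k x + dot l x.
Proof. by rewrite /dot -big_split; apply: eq_bigr => i _; rewrite mxE rmorphD mulrDl. Qed.

Lemma dotNl (R : pzRingType) d (k : 'rV[int]_d) (x : 'rV[R]_d) :
  dot (- k) x = - dot k x.
Proof. by rewrite /dot -sumrN; apply: eq_bigr => i _; rewrite mxE rmorphN mulNr. Qed.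

Lemma dot_basis_vec (R : realType) d (k : 'rV[int]_d) (i : 'I_d) :
  dot k (basis_vec i : 'rV[R]_d) = (k ord0 i)%:~R.
Proof.
rewrite /dot (bigD1 i) //= mxE !eqxx mulr1 big1 ?addr0 // => j /negbTE ji.
by rewrite mxE ji andbF mulr0.
Qed.

Lemma cos_periodz (R : realType) (x : R) (z : int) : cos (x + 2 * pi * z%:~R) = cos x.
Proof.
have pos (n : nat) y : cos (y + 2 * pi * n%:R) = cos y :> R.
  by rewrite -[RHS](periodicn (@cosD2pi R) n); congr cos; rewrite -mulr_natr -mulr_natr; ring.
case: z => n; first exact: pos.
by rewrite NegzE -[LHS](pos n.+1); congr cos; rewrite rmorphN /=; ring.
Qed.

(** A directional derivative depends only on the restriction to a line, which reduces it to
    one-variable calculus. *)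
Lemma is_derive_line (R : realType) (V : normedModType R) (f : V -> R) (a v : V) (df : R) :
  is_derive (0 : R) (1 : R) (fun t => f (t *: v + a)) df -> is_derive a v f df.
Proof.
move=> [D E].
have eqf : (fun h : R => h^-1 *: (((fun t => f (t *: v + a)) \o shift 0) (h *: 1) - f (0 *: v + a))) =
   (fun h => h^-1 *: ((f \o shift a) (h *: v) - f a)).
  by apply/funext => h; rewrite /= addr0 scale0r add0r /GRing.scale /= mulr1.
by split; [rewrite /derivable -eqf|rewrite /derive -eqf].
Qed.

(** A triple holds an amplitude, a frequency and a phase. Phases cover sines as well, and keep the
    family closed under differentiation, which shifts them by pi / 2. *)
Definition trig_poly (R : realType) d (s : seq (R * 'rV[int]_d * R)) (x : 'rV[R]_d) : R :=
  \sum_(t <- s) t.1.1 * cos (dot t.1.2 x + t.2).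

Definition trig_deriv (R : realType) d (i : 'I_d) (s : seq (R * 'rV[int]_d * R)) :=
  [seq (t.1.1 * (t.1.2 ord0 i)%:~R, t.1.2, t.2 + pi / 2) | t : R * 'rV[int]_d * R <- s].

Lemma is_derive_affine (R : realType) (k p y : R) :
  is_derive y (1 : R) (fun t => k * t + p) k.
Proof.
have -> : (fun t => k * t + p) = (k \*: (@id R : R -> R)) + cst p.
  by apply/funext => t; rewrite !fctE.
apply: is_derive_eq (is_deriveD (is_deriveZ _ (is_derive_id _ _)) (is_derive_cst _ _ _)) _.
by rewrite addr0 /GRing.scale /= mulr1.
Qed.

Lemma is_derive_trig_poly (R : realType) d (i : 'I_d) s (x : 'rV[R]_d) :
  is_derive x (basis_vec i) (trig_poly s) (trig_poly (trig_deriv i s) x).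
Proof.
elim: s => [|[[c q] p] s IHs].
  have -> : @trig_poly R d [::] = cst 0 by apply/funext => y; rewrite /trig_poly big_nil.
  exact: is_derive_cst.
have E : trig_poly ((c, q, p) :: s) =
    (fun y : 'rV[R]_d => c * cos (dot q y + p)) + trig_poly s.
  by apply/funext => y; rewrite /trig_poly big_cons.
have E' : trig_poly (trig_deriv i ((c, q, p) :: s)) x =
    c * (- sin (dot q x + p) * (q ord0 i)%:~R) + trig_poly (trig_deriv i s) x.
  rewrite /trig_poly /= big_cons /=; congr (_ + _).
  by rewrite addrA cosDpihalf; ring.
rewrite E E'; suff H1 : is_derive x (basis_vec i) (fun y : 'rV[R]_d => c * cos (dot q y + p))
    (c * (- sin (dot q x + p) * (q ord0 i)%:~R)) by exact: is_deriveD H1 IHs.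
apply: is_derive_line.
have -> : (fun t : R => c * cos (dot q (t *: basis_vec i + x) + p)) =
    c \*: (cos \o (fun t : R => (q ord0 i)%:~R * t + (dot q x + p))).
  by apply/funext => t /=; rewrite dotDr dotZr dot_basis_vec addrA [t * _]mulrC.
apply: is_deriveZ.
have := is_derive1_comp (is_derive_cos _) (is_derive_affine (q ord0 i)%:~R (dot q x + p) 0).
by rewrite mulr0 add0r.
Qed.

Lemma trig_poly_continuous (R : realType) d (s : seq (R * 'rV[int]_d * R)) :
  continuous (trig_poly s).
Proof.
have dotc (q : 'rV[int]_d) : continuous (fun x : 'rV[R]_d => dot q x).
  have H := @continuous_big R _ +%R 0 xpredT (@add_continuous R) 'rV[R]_d _
    (fun i x => (q ord0 i)%:~R * x ord0 i).
  apply: H => i _ x.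
  by apply: continuousM; [exact: cst_continuous|exact: coord_continuous].
have H := @continuous_big R _ +%R 0 xpredT (@add_continuous R) 'rV[R]_d s
  (fun t x => t.1.1 * cos (dot t.1.2 x + t.2)).
apply: H => t _ x.
apply: continuousM; first exact: cst_continuous.
apply: continuous_comp; last exact: continuous_cos.
by apply: continuousD; [exact: dotc|exact: cst_continuous].
Qed.

Lemma derive_trig_poly (R : realType) d (i : 'I_d) s :
  'D_(basis_vec i) (@trig_poly R d s) = trig_poly (trig_deriv i s).
Proof. by apply/funext => x; have [] := is_derive_trig_poly i s x. Qed.

Lemma trig_poly_smooth (R : realType) d s : smooth (@trig_poly R d s).
Proof.
move=> k; elim: k s => [|k IHk] s; first exact: trig_poly_continuous.
move=> i; split; last by rewrite derive_trig_poly.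
by move=> x; have [] := is_derive_trig_poly i s x.
Qed.

Lemma trig_poly_laplacian (R : realType) d s (n : nat) (x : 'rV[R]_d) :
  (forall t : R * 'rV[int]_d * R, t \in s -> \sum_i t.1.2 ord0 i ^+ 2 = n%:Z) ->
  laplacian (trig_poly s) x = - n%:R * trig_poly s x.
Proof.
move=> Hs; rewrite /laplacian.
have E i : 'D_(basis_vec i) ('D_(basis_vec i) (trig_poly s)) x =
    \sum_(t <- s) t.1.1 * (t.1.2 ord0 i)%:~R * (t.1.2 ord0 i)%:~R *
      cos (dot t.1.2 x + (t.2 + pi / 2 + pi / 2)).
  rewrite derive_trig_poly; have [_ ->] := is_derive_trig_poly i (trig_deriv i s) x.
  by rewrite /trig_poly /trig_deriv !big_map.
under eq_bigr do rewrite E.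
rewrite exchange_big mulr_sumr big_seq [RHS]big_seq; apply: eq_bigr => t ts /=.
have -> : n%:R = \sum_i (t.1.2 ord0 i)%:~R ^+ 2 :> R.
  have -> : n%:R = (n%:Z)%:~R :> R by [].
  rewrite -(Hs t ts) rmorph_sum /=.
  by apply: eq_bigr => i _; rewrite rmorphXn.
rewrite -sumrN mulr_suml; apply: eq_bigr => i _.
by rewrite !addrA cosDpihalf sinDpihalf; ring.
Qed.

Lemma trig_poly_periodic (R : realType) d s (k : 'rV[int]_d) (x : 'rV[R]_d) :
  trig_poly s (x + (2 * pi) *: map_mx intr k) = trig_poly s x.
Proof.
apply: eq_bigr => t _; congr (_ * _).
have -> : dot t.1.2 (x + (2 * pi) *: map_mx intr k) + t.2 =
    (dot t.1.2 x + t.2) + 2 * pi * (\sum_i t.1.2 ord0 i * k ord0 i)%:~R.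
  rewrite dotDr dotZr addrAC; congr (_ + _ * _).
  by rewrite /dot rmorph_sum; apply: eq_bigr => i _; rewrite mxE rmorphM.
exact: cos_periodz.
Qed.

(** * Integration over the torus *)

Lemma measurable_dot (R : realType) d (q : 'rV[int]_d) :
  measurable_fun [set: 'rV[R]_d] (dot q).
Proof.
apply: measurable_sum => i; apply: measurable_funM; first exact: measurable_cst.
exact: measurable_coord.
Qed.

Lemma measurable_trig_poly (R : realType) d s :
  measurable_fun [set: 'rV[R]_d] (trig_poly s).
Proof.
apply: measurable_sum => t; apply: measurable_funM; first exact: measurable_cst.
apply: measurableT_comp; first exact: continuous_measurable_fun (@continuous_cos R).
by apply: measurable_funD; [exact: measurable_dot|exact: measurable_cst].
Qed.

Lemma measurable_torus_cell (R : realType) d : measurable (@torus_cell R d).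
Proof.
have -> : @torus_cell R d =
    \bigcap_(i in [set: 'I_d]) ((fun x : 'rV[R]_d => x ord0 i) @^-1` `[0, 2 * pi[%classic).
  apply/seteqP; split=> x /= H i; first by move=> _; rewrite /= in_itv /=; exact: H.
  by have := H i Logic.I; rewrite /= in_itv.
apply: fin_bigcap_measurable => // i _.
by rewrite -[X in measurable X]setTI; apply: measurable_coord.
Qed.

Lemma measurable_euclid_ball (R : realType) d (r : R) :
  measurable (@euclid_ball R d r).
Proof.
have -> : @euclid_ball R d r =
    (fun x : 'rV[R]_d => Num.sqrt (\sum_i x ord0 i ^+ 2)) @^-1` `]-oo, r[%classic.
  by apply/seteqP; split=> x /=; rewrite in_itv.
rewrite -[X in measurable X]setTI.
have mf : measurable_fun [set: 'rV[R]_d] (fun x => Num.sqrt (\sum_i x ord0 i ^+ 2)).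
  apply: measurableT_comp; first exact: continuous_measurable_fun (@sqrt_continuous R).
  apply: measurable_sum => i; apply: measurable_funX; exact: measurable_coord.
exact: mf.
Qed.

Lemma torus_cell_row_cons (R : realType) d :
  @row_cons R d @^-1` (@torus_cell R d.+1) = `[0, 2 * pi[%classic `*` @torus_cell R d.
Proof.
apply/seteqP; split=> -[a x] /=.
  move=> H; split; first by have := H ord0; rewrite mxE unlift_none /= in_itv.
  by move=> i; have := H (lift ord0 i); rewrite mxE liftK.
move=> [Ha Hx] i; rewrite mxE; case: (unliftP ord0 i) => [j|] _ /=; first exact: Hx.
by move: Ha; rewrite in_itv.
Qed.

Lemma lebesgue_measure_period (R : realType) :
  lebesgue_measure (`[0, 2 * pi[%classic : set R) = (2 * pi)%:E.
Proof. by rewrite lebesgue_measure_itv /= lte_fin pmulr_rgt0 // pi_gt0 oppr0 adde0. Qed.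

Lemma lebesgue_rV_torus_cell (R : realType) d :
  lebesgue_rV d (@torus_cell R d) = ((2 * pi) ^+ d)%:E.
Proof.
elim: d => [|d IHd].
  by rewrite /= diracE mem_set // => -[].
rewrite /= /lebesgue_succ /pushforward torus_cell_row_cons product_measure1E //; last first.
  exact: measurable_torus_cell.
rewrite IHd; transitivity ((2 * pi)%:E * ((2 * pi) ^+ d)%:E : \bar R)%E.
  by congr (_ * _)%E; exact: lebesgue_measure_period.
by rewrite -EFinM -exprS.
Qed.

Lemma lebesgue_rV_torus_cell_lty (R : realType) d :
  (lebesgue_rV d (@torus_cell R d) < +oo)%E.
Proof. by rewrite lebesgue_rV_torus_cell ltry. Qed.

Lemma bounded_trig_poly (R : realType) d s (A : set 'rV[R]_d) :
  [bounded trig_poly s x | x in A].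
Proof.
exists (\sum_(t <- s) `|t.1.1|); split; first exact: num_real.
move=> M /ltW HM x _; apply: le_trans HM; apply: le_trans (ler_norm_sum _ _ _) _.
apply: ler_sum => t _; rewrite normrM -[X in _ <= X]mulr1 ler_wpM2l //.
by rewrite ler_norml cos_geN1 cos_le1.
Qed.

Lemma integrable_trig_poly (R : realType) d s :
  (@lebesgue_rV R d).-integrable (@torus_cell R d) (EFin \o trig_poly s).
Proof.
apply: measurable_bounded_integrable.
- exact: measurable_torus_cell.
- exact: lebesgue_rV_torus_cell_lty.
- exact: measurable_funTS (measurable_trig_poly s).
- exact: bounded_trig_poly.
Qed.

Lemma integral_cos_period (R : realType) (k : int) (p : R) :
  (\int[lebesgue_measure]_(a in `[0%R, (2 * pi)%R[) (cos (k%:~R * a + p))%:E)%E =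
  (if k == 0 then 2 * pi * cos p else 0)%:E.
Proof.
have p2 : 0 < 2 * pi :> R by rewrite pmulr_rgt0 // pi_gt0.
have cc : continuous (fun a : R => cos (k%:~R * a + p)).
  move=> a; apply: continuous_comp; last exact: continuous_cos.
  apply: continuousD; last exact: cst_continuous.
  apply: continuousM; [exact: cst_continuous|exact: cvg_id].
have [k0|k0] := eqVneq k 0.
  rewrite (eq_integral (cst (cos p)%:E)); last by move=> a _; rewrite k0 mul0r add0r.
  rewrite integral_cst //= lebesgue_measure_period.
  by rewrite -EFinM mulrC.
have kR : k%:~R != 0 :> R by rewrite intr_eq0.
rewrite integral_itv_bndo_bndc; last first.
  apply/measurable_EFinP; apply: measurable_funTS.
  exact: continuous_measurable_fun.
pose F (a : R) : R := k%:~R^-1 * sin (k%:~R * a + p).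
have dF (a : R) : is_derive a (1 : R) F (cos (k%:~R * a + p)).
  have -> : F = k%:~R^-1 \*: (sin \o (fun a => k%:~R * a + p)) by apply/funext => t; rewrite /F !fctE.
  apply: is_derive_eq (is_deriveZ _ (is_derive1_comp (is_derive_sin _) (is_derive_affine _ _ _))) _.
  by rewrite /GRing.scale /= mulrCA mulVf ?mulr1.
have cF : continuous F.
  move=> a; apply: differentiable_continuous.
  by apply/derivable1_diffP; have [] := dF a.
rewrite (continuous_FTC2 (F := F)) //.
- rewrite -EFinB; congr (_%:E); rewrite /F mulr0 add0r.
  (* The sine is turned into a cosine so that [cos_periodz] shows that F takes equal values at both
     ends. *)
  rewrite (_ : k%:~R * (2 * pi) + p = p + pi / 2 + 2 * pi * k%:~R - pi / 2); last by ring.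
  by rewrite sinBpihalf cos_periodz cosDpihalf opprK subrr.
- exact: continuous_subspaceT.
- split.
  + by move=> a _; have [] := dF a.
  + by apply: cvg_at_right_filter; exact: cF.
  + by apply: cvg_at_left_filter; exact: cF.
- by move=> a _; rewrite derive1E; have [] := dF a.
Qed.

(** Fubini for the extension of f by zero outside the rectangle. *)
Lemma integral_prod_rect d1 d2 (T1 : measurableType d1) (T2 : measurableType d2)
    (R : realType) (m1 : {sigma_finite_measure set T1 -> \bar R})
    (m2 : {sigma_finite_measure set T2 -> \bar R}) (A : set T1) (B : set T2)
    (f : T1 * T2 -> \bar R) :
  measurable A -> measurable B -> (m1 \x m2)%E.-integrable (A `*` B) f ->
  (\int[m1 \x m2]_(z in A `*` B) f z =
   \int[m1]_(x in A) \int[m2]_(y in B) f (x, y))%E.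
Proof.
move=> mA mB intf; rewrite integral_mkcond -integral12_prod_meas1; last first.
  exact/(integrable_mkcond f (measurableX mA mB)).
rewrite [RHS]integral_mkcond; apply: eq_integral => x _.
rewrite /fubini_F patchE; case: ifPn => xA.
  rewrite [RHS]integral_mkcond; apply: eq_integral => y _.
  by rewrite !patchE in_setX xA.
rewrite (eq_integral (cst 0%E)) ?integral0 // => y _.
by rewrite patchE in_setX (negbTE xA).
Qed.

Lemma integral_lebesgue_succ (R : realType) d
    (mu : {sigma_finite_measure set 'rV[R]_d -> \bar R}) (D : set 'rV[R]_d.+1)
    (f : 'rV[R]_d.+1 -> \bar R) :
  measurable_fun [set: 'rV[R]_d.+1] f -> measurable D ->
  (@lebesgue_measure R \x mu)%E.-integrable (@row_cons R d @^-1` D) (f \o @row_cons R d) ->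
  (\int[lebesgue_succ mu]_(y in D) f y =
   \int[@lebesgue_measure R \x mu]_(z in @row_cons R d @^-1` D) f (row_cons z))%E.
Proof.
move=> mf mD intf.
exact: (@integral_pushforward _ _ (measurableTypeR R * 'rV[R]_d)%type 'rV[R]_d.+1 R
  (@row_cons R d) (@measurable_row_cons R d) (lebesgue_measure \x mu)%E D f mf intf mD).
Qed.

(** Induction on d with arbitrary phase: when the other coordinates are integrated, the first one
    only contributes to the phase. *)
Lemma integral_cos_torus (R : realType) d (q : 'rV[int]_d) (p : R) :
  (\int[lebesgue_rV d]_(x in torus_cell) (cos (dot q x + p))%:E)%E =
  (if q == 0 then (2 * pi) ^+ d * cos p else 0)%:E.
Proof.
elim: d q p => [|d IHd] q p.
  rewrite (eq_integral (cst (cos p)%:E)); last by move=> x _; rewrite /dot big_ord0 add0r.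
  transitivity ((cos p)%:E * lebesgue_rV 0 (@torus_cell R 0))%E.
    exact: (integral_cst (lebesgue_rV 0) (@measurable_torus_cell R 0)).
  rewrite lebesgue_rV_torus_cell -EFinM mulrC.
  by rewrite (_ : q = 0) ?eqxx //; apply/rowP => -[].
pose f (x : 'rV[R]_d.+1) := (cos (dot q x + p))%:E.
have fE : f = EFin \o trig_poly [:: (1, q, p)].
  by apply/funext => x; rewrite /f /trig_poly /= big_seq1 mul1r.
have mf : measurable_fun [set: 'rV[R]_d.+1] f.
  by rewrite fE; apply/measurable_EFinP; exact: measurable_trig_poly.
have intf : (@lebesgue_measure R \x lebesgue_rV d)%E.-integrable
    (`[0, 2 * pi[%classic `*` @torus_cell R d) (f \o @row_cons R d).
  rewrite fE -compA; apply: measurable_bounded_integrable.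
  - by apply: measurableX => //; exact: measurable_torus_cell.
  - by have := @lebesgue_rV_torus_cell_lty R d.+1;
      rewrite /= /lebesgue_succ /pushforward torus_cell_row_cons.
  - apply: measurable_funTS; apply: measurableT_comp; first exact: measurable_trig_poly.
    exact: measurable_row_cons.
  - have [M [Mr HM]] := bounded_trig_poly [:: (1, q, p)] [set: 'rV[R]_d.+1].
    by exists M; split => // N MN z _; exact: HM.
have -> : (\int[lebesgue_rV d.+1]_(x in torus_cell) f x =
    \int[lebesgue_measure]_(a in `[0%R, (2 * pi)%R[)
      \int[lebesgue_rV d]_(x in torus_cell) f (row_cons (a, x)))%E.
  rewrite [lebesgue_rV _]/= integral_lebesgue_succ //.
  - rewrite torus_cell_row_cons.
    apply: (@integral_prod_rect _ _ (measurableTypeR R) 'rV[R]_d R lebesgue_measure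
      (lebesgue_rV d) _ _ (f \o @row_cons R d)) => //.
    exact: measurable_torus_cell.
  - exact: measurable_torus_cell.
  - by rewrite torus_cell_row_cons.
pose q' : 'rV[int]_d := \row_i q ord0 (lift ord0 i).
have dotE a x : dot q (row_cons (a, x)) + p = dot q' x + ((q ord0 ord0)%:~R * a + p).
  rewrite /dot big_ord_recl mxE unlift_none /= addrCA addrA; congr (_ + _ + _).
  by apply: eq_bigr => i _; rewrite !mxE liftK.
have q0E : (q == 0) = (q' == 0) && (q ord0 ord0 == 0).
  apply/eqP/andP => [q0|[/eqP/rowP q'0 /eqP q00]].
    by split; apply/eqP; [apply/rowP => i; rewrite /q' q0 !mxE|rewrite q0 mxE].
  apply/rowP => i; rewrite [RHS]mxE; case: (unliftP ord0 i) => [j|] -> //.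
  by have := q'0 j; rewrite !mxE.
pose v : R := if q' == 0 then (2 * pi) ^+ d else 0.
transitivity (\int[lebesgue_measure]_(a in `[0%R, (2 * pi)%R[)
    (v%:E * (cos ((q ord0 ord0)%:~R * a + p))%:E))%E.
  apply: eq_integral => a _.
  rewrite (eq_integral (fun x : 'rV[R]_d => (cos (dot q' x + ((q ord0 ord0)%:~R * a + p)))%:E)).
    by rewrite IHd -EFinM /v; case: (q' == 0); rewrite ?mul0r.
  by move=> x _; rewrite /f dotE.
have cosc : continuous (fun a : R => cos ((q ord0 ord0)%:~R * a + p)).
  move=> a; apply: continuous_comp; last exact: continuous_cos.
  apply: continuousD; last exact: cst_continuous.
  by apply: continuousM; [exact: cst_continuous|exact: cvg_id].
rewrite integralZl //=; last first.
  apply: measurable_bounded_integrable => //.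
  - by apply: le_lt_trans (ltry (2 * pi : R)); rewrite le_eqVlt -lebesgue_measure_period eqxx.
  - by apply: measurable_funTS; exact: continuous_measurable_fun.
  - exists 1; split => // M /ltW M1 a _ /=; apply: le_trans M1.
    by rewrite ler_norml cos_geN1 cos_le1.
rewrite integral_cos_period -EFinM q0E /v.
case: (q' == 0); case: (_ == 0); rewrite ?mul0r ?mulr0 //= exprSr; congr (_%:E); ring.
Qed.

(** Cauchy-Schwarz by Lagrange's identity: twice the defect is the sum of (f_i g_j - f_j g_i)^2 over
    all i and j. *)
Lemma sum_sqr_le (R : realDomainType) (I : finType) (f g : I -> R) :
  (\sum_i f i * g i) ^+ 2 <= (\sum_i f i ^+ 2) * (\sum_i g i ^+ 2).
Proof.
suff : 0 <= ((\sum_i f i ^+ 2) * (\sum_i g i ^+ 2) - (\sum_i f i * g i) ^+ 2) *+ 2.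
  by rewrite pmulrn_lge0 // subr_ge0.
have -> : ((\sum_i f i ^+ 2) * (\sum_i g i ^+ 2) - (\sum_i f i * g i) ^+ 2) *+ 2 =
    \sum_i \sum_j (f i * g j - f j * g i) ^+ 2.
  have E (u v : I -> R) : (\sum_i u i) * (\sum_i v i) = \sum_i \sum_j u i * v j.
    by rewrite mulr_suml; apply: eq_bigr => i _; rewrite mulr_sumr.
  rewrite mulr2n [X in _ + (X - _)]mulrC expr2 !E -!sumrB -big_split.
  apply: eq_bigr => i _; rewrite -!sumrB -big_split; apply: eq_bigr => j _ /=.
  by ring.
by apply: sumr_ge0 => i _; apply: sumr_ge0 => j _; exact: sqr_ge0.
Qed.

Lemma Rintegral_trig_poly (R : realType) d s :
  \int[lebesgue_rV d]_(x in torus_cell) trig_poly s x =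
  (2 * pi) ^+ d * \sum_(t <- s | t.1.2 == 0) t.1.1 * cos t.2 :> R.
Proof.
elim: s => [|[[c q] p] s IHs].
  rewrite big_nil mulr0 (@eq_Rintegral _ _ _ _ _ (cst 0)); last by move=> x _; rewrite /trig_poly big_nil.
  by rewrite Rintegral_cst ?mul0r //; exact: measurable_torus_cell.
pose t1 : seq (R * 'rV[int]_d * R) := [:: (1, q, p)].
rewrite (@eq_Rintegral _ _ _ _ _ (fun x => c * trig_poly t1 x + trig_poly s x)); last first.
  by move=> x _; rewrite /trig_poly big_cons big_seq1 mul1r.
have mc := @measurable_torus_cell R d.
have it1 := integrable_trig_poly t1.
rewrite RintegralD //; last 2 first.
- exact: (integrableZl mc c it1).
- exact: integrable_trig_poly.
rewrite RintegralZl // IHs.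
have -> : \int[lebesgue_rV d]_(x in torus_cell) trig_poly t1 x =
    if q == 0 then (2 * pi) ^+ d * cos p else 0.
  rewrite (@eq_Rintegral _ _ _ _ _ (fun x : 'rV[R]_d => cos (dot q x + p))).
    by rewrite /Rintegral integral_cos_torus.
  by move=> x _; rewrite /trig_poly big_seq1 mul1r.
by rewrite big_cons /=; case: eqP => _; ring.
Qed.

Definition wave (R : realType) d N (K : 'I_N -> 'rV[int]_d) (a : 'rV[R]_N) :=
  trig_poly [seq (a ord0 l, K l, - (pi / 4)) | l <- index_enum 'I_N].

Lemma waveE (R : realType) d N (K : 'I_N -> 'rV[int]_d) (a : 'rV[R]_N) x :
  wave K a x = \sum_l a ord0 l * cos (dot (K l) x - pi / 4).
Proof. by rewrite /wave /trig_poly big_map. Qed.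

(* With phase [- pi / 4] the squares have no nonconstant mean: the product of
   the waves at [k] and [l] is [(cos ((k - l).x) + sin ((k + l).x)) / 2], and
   the sine has mean [0] even when [k = - l]. *)
Lemma wave_mean_square (R : realType) d N (K : 'I_N -> 'rV[int]_d) (a : 'rV[R]_N) :
  injective K ->
  \int[lebesgue_rV d]_(x in torus_cell) wave K a x ^+ 2 =
  (2 * pi) ^+ d * ((\sum_l a ord0 l ^+ 2) / 2) :> R.
Proof.
move=> injK.
pose s1 := [seq (a ord0 l * a ord0 m / 2, K l - K m, 0 : R)
  | l <- index_enum 'I_N, m <- index_enum 'I_N].
pose s2 := [seq (a ord0 l * a ord0 m / 2, K l + K m, - (pi / 2) : R)
  | l <- index_enum 'I_N, m <- index_enum 'I_N].
rewrite (@eq_Rintegral _ _ _ _ _ (trig_poly (s1 ++ s2))); last first.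
  move=> x _; rewrite waveE /trig_poly big_cat !big_allpairs_dep /= -big_split /= expr2 mulr_suml.
  apply: eq_bigr => l _; rewrite mulr_sumr -big_split; apply: eq_bigr => m _ /=.
  rewrite addr0 !dotDl dotNl cosBpihalf.
  set u := dot (K l) x; set v := dot (K m) x.
  have -> : u - v = (u - pi / 4) - (v - pi / 4) by ring.
  have -> : sin (u + v) = cos ((u - pi / 4) + (v - pi / 4)).
    by rewrite -cosBpihalf; congr cos; field.
  by rewrite (cosD (u - pi / 4) (v - pi / 4)) (cosB (u - pi / 4) (v - pi / 4)); field.
rewrite Rintegral_trig_poly; congr (_ * _).
rewrite big_mkcond big_cat !big_allpairs_dep /= [X in _ + X]big1 ?addr0 => [|l _]; last first.
  by rewrite big1 // => m _; rewrite cosN cos_pihalf mulr0 if_same.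
rewrite mulr_suml; apply: eq_bigr => l _; rewrite (bigD1 l) //= subrr eqxx cos0 mulr1.
rewrite big1 ?addr0 ?expr2 // => m ml; rewrite subr_eq0 (inj_eq injK) eq_sym.
by rewrite (negbTE ml).
Qed.

(** Here [h j] is the j-th derivative of the wave along the segment from 0 to x. All terms share one
    phase, so at 0 it is a constant times the j-th moment, which vanishes for j < M. *)
Lemma normr_wave_le (R : realType) d N (K : 'I_N -> 'rV[int]_d) (a : 'rV[R]_N) M T x :
  (forall j, (j < M)%N -> \sum_l a ord0 l * dot (K l) x ^+ j = 0) ->
  (forall l, `|dot (K l) x| <= T) ->
  `|wave K a x| <= (\sum_l `|a ord0 l|) * T ^+ M / M`!%:R.
Proof.
move=> a0 leT.
pose h j (y : R) := \sum_l a ord0 l * dot (K l) x ^+ j *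
  cos (y * dot (K l) x - pi / 4 + (pi / 2) *+ j).
have h01 : wave K a x = h 0%N 1.
  by rewrite waveE; apply: eq_bigr => l _; rewrite expr0 mulr1 mul1r mulr0n addr0.
have := @derive_tower_bound R h ((\sum_l `|a ord0 l|) * T ^+ M) M.
rewrite h01 => /(_ _ _ _ 1); rewrite expr1n mulr1; apply; last by rewrite ler01 lexx.
- move=> j y.
  have -> : h j = \sum_(l < N) (fun y => a ord0 l * dot (K l) x ^+ j *
      cos (y * dot (K l) x - pi / 4 + (pi / 2) *+ j)).
    by apply/funext => z; rewrite fct_sumE.
  apply: is_derive_sum => l.
  have -> : (fun y => a ord0 l * dot (K l) x ^+ j *
        cos (y * dot (K l) x - pi / 4 + (pi / 2) *+ j)) =
      (a ord0 l * dot (K l) x ^+ j) \*: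
        (cos \o (fun y => dot (K l) x * y + (- (pi / 4) + (pi / 2) *+ j))).
    by apply/funext => z /=; rewrite addrA [z * _]mulrC.
  apply: is_derive_eq (is_deriveZ _ (is_derive1_comp (is_derive_cos _) (is_derive_affine _ _ _))) _.
  have -> : y * dot (K l) x - pi / 4 + (pi / 2) *+ j.+1 =
      (dot (K l) x * y + (- (pi / 4) + (pi / 2) *+ j)) + pi / 2 by rewrite mulrSr; ring.
  by rewrite cosDpihalf exprS /GRing.scale /=; ring.
- move=> j jM; rewrite /h.
  under eq_bigr do rewrite mul0r add0r.
  by rewrite -mulr_suml a0 ?mul0r.
- move=> y _; apply: le_trans (ler_norm_sum _ _ _) _; rewrite mulr_suml.
  apply: ler_sum => l _; rewrite !normrM -[X in _ <= X]mulr1 normrX.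
  rewrite ler_pM ?mulr_ge0 ?exprn_ge0 //.
    by rewrite ler_wpM2l // lerXn2r ?nnegrE // (le_trans _ (leT l)).
  by rewrite ler_norml cos_geN1 cos_le1.
Qed.

(** * The observability constant *)

Lemma average_le (R : realType) d (A : set 'rV[R]_d) (f : 'rV[R]_d -> R) (B : R) :
  measurable A -> measurable_fun [set: 'rV[R]_d] f -> 0 <= B ->
  (forall x, A x -> 0 <= f x <= B) -> average A f <= B.
Proof.
move=> mA mf B0 fB; rewrite /average.
(* [fine] sends an infinite measure to 0 and the inverse of 0 is 0, so for A of null or infinite
   measure the average is 0. *)
have [->|muA0] := eqVneq (fine (lebesgue_rV d A)) 0; first by rewrite invr0 mulr0.
have muA_ge0 : 0 <= fine (lebesgue_rV d A) by rewrite fine_ge0.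
have Afin : (lebesgue_rV d A < +oo)%E.
  by move: muA0; case: (lebesgue_rV d A) (measure_ge0 (lebesgue_rV d) A) => [r||] //=;
    rewrite ?ltry ?eqxx.
rewrite ler_pdivrMr; last by rewrite lt_neqAle eq_sym muA0.
rewrite -Rintegral_cst //; apply: le_Rintegral => //.
- apply: measurable_bounded_integrable => //; first exact: measurable_funTS.
  exists B; split; first exact: num_real.
  by move=> M /ltW BM x Ax; have /andP[f0 fb] := fB x Ax; rewrite /= ger0_norm // (le_trans fb).
- apply: measurable_bounded_integrable => //.
  exists B; split; first exact: num_real.
  by move=> M /ltW BM x Ax; rewrite /= ger0_norm.
- by move=> x /fB /andP[].
Qed.

Lemma normr_dot_le (R : realType) d (k : 'rV[int]_d) (lam r : R) (x : 'rV[R]_d) :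
  0 <= lam -> 0 <= r -> (\sum_i k ord0 i ^+ 2)%:~R = lam ^+ 2 ->
  euclid_ball r x -> `|dot k x| <= lam * r.
Proof.
move=> lam0 r0 kE xr; rewrite -ler_sqr ?nnegrE ?mulr_ge0 // real_normK ?num_real //.
apply: le_trans (sum_sqr_le _ _) _; rewrite exprMn -kE rmorph_sum /=.
under [X in _ <= X * _]eq_bigr do rewrite rmorphXn /=.
apply: ler_wpM2l; first by apply: sumr_ge0 => i _; exact: sqr_ge0.
rewrite -(sqr_sqrtr (_ : 0 <= \sum_i x ord0 i ^+ 2)); last first.
  by apply: sumr_ge0 => i _; exact: sqr_ge0.
by rewrite ler_sqr ?nnegrE ?sqrtr_ge0 // ltW.
Qed.

(** The wave is the test function. With S the sum of the a_l^2, its mean square is S / 2 on the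
    torus, and at most N S ((lam r)^M / M!)^2 on the ball by Cauchy-Schwarz; the ratio gives the
    factor 2 N. *)
Lemma observability_le_vanishing (R : realType) d N M (n : nat) (lam r : R)
    (K : 'I_N -> 'rV[int]_d) (a : 'rV[R]_N) :
  0 <= lam -> 0 <= r -> lam ^+ 2 = n%:R -> injective K ->
  (forall l, \sum_i K l ord0 i ^+ 2 = n%:Z) -> a != 0 ->
  (forall j x, (j < M)%N -> \sum_l a ord0 l * dot (K l) x ^+ j = 0) ->
  (observability d lam r <= (2 * N%:R * ((lam * r) ^+ M / M`!%:R) ^+ 2)%:E)%E.
Proof.
move=> lam0 r0 lamE injK normK a0 van.
pose u (x : 'rV[R]_d) : R[i] := Complex (wave K a x) 0.
have normu x : ComplexField.Normc.normc (u x) ^+ 2 = wave K a x ^+ 2.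
  by rewrite /= expr0n /= addr0 sqr_sqrtr ?sqr_ge0.
pose S := \sum_l a ord0 l ^+ 2.
have S_gt0 : 0 < S.
  rewrite lt_neqAle sumr_ge0 ?andbT; last by move=> l _; exact: sqr_ge0.
  rewrite eq_sym psumr_eq0; last by move=> l _; exact: sqr_ge0.
  apply/negP => /allP H; case/negP: a0; apply/eqP/rowP => l; rewrite mxE.
  by have := H l; rewrite mem_index_enum sqrf_eq0 => /(_ isT) /eqP.
have pi2_gt0 : 0 < (2 * pi : R) ^+ d by rewrite exprn_gt0 // mulr_gt0 ?pi_gt0.
have msT : mean_square torus_cell u = S / 2.
  rewrite /mean_square /average lebesgue_rV_torus_cell /=.
  rewrite (@eq_Rintegral _ _ _ _ _ (fun x => wave K a x ^+ 2)); last by move=> x _; rewrite normu.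
  by rewrite wave_mean_square // mulrC mulKf // gt_eqF.
have zero_trig : (fun _ : 'rV[R]_d => 0 : R) = trig_poly [::].
  by apply/funext => x; rewrite /trig_poly big_nil.
have uE : torus_eigenspace lam u.
  split.
  - by move=> k x; rewrite /u /wave trig_poly_periodic.
  - by split; rewrite /= ?zero_trig; exact: trig_poly_smooth.
  - move=> x; rewrite /claplacian /= zero_trig !(@trig_poly_laplacian _ _ _ n) //; last first.
      by move=> t /mapP[l _ ->]; exact: normK.
    rewrite -zero_trig mulr0 lamE /u -/(wave K a).
    by apply/eqP; rewrite eq_complex /=; apply/andP; split; apply/eqP; ring.
have un0 : u <> cst 0.
  move=> u0; move: msT; rewrite /mean_square /average u0.
  rewrite (@eq_Rintegral _ _ _ _ _ (cst 0)); last first.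
    by move=> x _ /=; rewrite expr0n /= addr0 sqrtr0 expr0n.
  rewrite Rintegral_cst; last exact: measurable_torus_cell.
  by rewrite !mul0r => /esym/eqP; rewrite mulf_eq0 invr_eq0 pnatr_eq0 orbF gt_eqF.
apply: (@le_trans _ _ (mean_square (euclid_ball r) u / mean_square torus_cell u)%:E).
  by apply: ereal_inf_lbound; exists u.
rewrite lee_fin msT ler_pdivrMr ?divr_gt0 //.
set b := (lam * r) ^+ M / M`!%:R.
have b0 : 0 <= b by rewrite divr_ge0 // exprn_ge0 // mulr_ge0.
have -> : 2 * N%:R * b ^+ 2 * (S / 2) = (N%:R * S) * b ^+ 2 by field.
have sum_le : (\sum_l `|a ord0 l|) ^+ 2 <= N%:R * S.
  have := sum_sqr_le (fun=> 1) (fun l => `|a ord0 l|).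
  under [in X in X -> _]eq_bigr do rewrite mul1r.
  under [X in _ <= _ * X -> _]eq_bigr do rewrite real_normK ?num_real //.
  by under [X in _ <= X * _ -> _]eq_bigr do rewrite expr1n; rewrite sumr_const card_ord.
apply: average_le.
- exact: measurable_euclid_ball.
- under eq_fun do rewrite normu.
  by apply: measurable_funX; exact: measurable_trig_poly.
- by rewrite mulr_ge0 ?sqr_ge0 // mulr_ge0 // ltW.
- move=> x xr; rewrite normu sqr_ge0 /=.
  apply: (@le_trans _ _ (((\sum_l `|a ord0 l|) * b) ^+ 2)); last first.
    by rewrite exprMn ler_wpM2r ?sqr_ge0.
  rewrite -[wave K a x ^+ 2]real_normK ?num_real //.
  rewrite ler_sqr ?nnegrE //; last by apply: mulr_ge0 b0; apply: sumr_ge0.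
  rewrite /b mulrA; apply: normr_wave_le => [j|l]; first exact: van.
  by apply: normr_dot_le => //; rewrite normK lamE.
Qed.

(** * Choice of the vanishing order and of the constants *)

(** Y is eliminated: lam <= 6 e Y gives lam^(e+2) <= (6 e Y)^e n, and Y^e n is at most 24 times the
    number of points. *)
Lemma sphere_points_growth (R : realType) (e n : nat) (lam : R) :
  (0 < e)%N -> 1 <= lam -> lam ^+ 2 = n%:R ->
  exists s : seq 'rV[int]_(4 + e),
    [/\ uniq s, forall v, v \in s -> \sum_i v ord0 i ^+ 2 = n%:Z, (2 <= size s)%N &
        lam ^+ e.+2 <= (24 * (6 * e) ^ e)%N%:R * (size s)%:R].
Proof.
move=> e0 lam1 lamE; have lam0 : 0 <= lam by apply: le_trans lam1.
have n0 : (0 < n)%N by rewrite -(ltr0n R) -lamE exprn_gt0 // (lt_le_trans _ lam1).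
have [s [Y [us ns nY sz s2]]] := sphere_points e0 n0.
exists s; split=> //.
have lamY : lam <= (6 * e * Y)%N%:R.
  by rewrite -ler_sqr ?nnegrE // lamE -natrX ler_nat.
apply: (@le_trans _ _ (((6 * e * Y) ^ e)%N%:R * n%:R)).
  by rewrite -addn2 exprD lamE ler_wpM2r // natrX lerXn2r ?nnegrE.
rewrite -!natrM ler_nat expnMn -mulnA -[X in (_ <= X)%N]mulnA [X in (_ <= X)%N]mulnCA.
by rewrite leq_mul2l sz orbT.
Qed.

(** M^M / M! is one term of the series of exp(M). *)
Lemma expn_div_fact_le_expR (R : realType) (M : nat) :
  M%:R ^+ M / M`!%:R <= expR 1 ^+ M :> R.
Proof.
case: M => [|M]; first by rewrite !expr0 fact0 divr1.
rewrite -expRM_natl mulr1; apply: le_trans (expR_ge1Dxn M (ler0n R M.+1)).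
by rewrite lerDr.
Qed.

(** The polynomial number of points is absorbed into the base: 2 M^D + 1 <= 3 M^D and M^D <=
    (2^D)^(2 M), whence the constant 6 and the factor 2^D. *)
Lemma vanishing_bound_simpl (R : realType) (D M : nat) (T : R) :
  (0 < M)%N -> 0 <= T ->
  2 * (minn 2 M * M ^ D).+1%:R * (T ^+ M / M`!%:R) ^+ 2 <=
    6 * (2 ^+ D * (expR 1 * T / M%:R)) ^+ (2 * M).
Proof.
move=> M0 T0; have MR : 0 < M%:R :> R by rewrite ltr0n.
have H1 : T ^+ M / M`!%:R <= (expR 1 * T / M%:R) ^+ M.
  have -> : T ^+ M / M`!%:R = M%:R ^+ M / M`!%:R * (T / M%:R) ^+ M.
    rewrite expr_div_n; field.
    by rewrite expf_neq0 ?gt_eqF // ltr0n fact_gt0.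
  have -> : (expR 1 * T / M%:R) ^+ M = expR 1 ^+ M * (T / M%:R) ^+ M.
    by rewrite -exprMn mulrA.
  rewrite ler_wpM2r ?exprn_ge0 ?divr_ge0 //.
  exact: expn_div_fact_le_expR.
have H2 : (minn 2 M * M ^ D).+1%:R <= 3 * (2 ^+ D) ^+ (2 * M) :> R.
  rewrite -!natrX -natrM ler_nat.
  have : (M ^ D <= (2 ^ D) ^ (2 * M))%N.
    rewrite -expnM mulnC expnM; case: D => // D; rewrite leq_exp2r //.
    by apply: leq_trans (ltnW (ltn_expl M (ltnSn 1))) _; rewrite leq_pexp2l // leq_pmull.
  have : (0 < M ^ D)%N by rewrite expn_gt0 M0.
  have : (minn 2 M * M ^ D <= 2 * M ^ D)%N by rewrite leq_mul2r geq_minl orbT.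
  by clear; lia.
have E (w z : R) : 6 * (w * z) ^+ (2 * M) = 2 * (3 * w ^+ (2 * M) * (z ^+ M) ^+ 2).
  by rewrite exprMn -[(z ^+ M) ^+ 2]exprM (mulnC M); ring.
rewrite E -mulrA.
rewrite ler_pM2l //; apply: ler_pM => //.
  by rewrite sqr_ge0.
by rewrite lerXn2r // nnegrE ?divr_ge0 ?exprn_ge0 ?mulr_ge0 ?expR_ge0 ?invr_ge0 // ltW.
Qed.

(** M is the integer part of mu / (3 G), or 1 if that quotient is below 2. In the first case 2 M^D
    <= 2 mu^D / (3 G) <= (2/3) S < S, and M + 1 <= 2 M gives the lower bound on M. *)
Lemma vanishing_order_exists (R : realType) (D S : nat) (G mu : R) :
  (0 < D)%N -> 1 <= G -> 0 <= mu -> (2 <= S)%N -> mu ^+ D <= G * S%:R ->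
  exists M : nat, [/\ (0 < M)%N, (minn 2 M * M ^ D < S)%N &
    (3 * G)^-1 * mu <= 2 * M%:R].
Proof.
move=> D0 G1 mu0 S2 muS; have G0 : 0 < G by apply: lt_le_trans G1.
set dl := (3 * G)^-1.
have dl0 : 0 < dl by rewrite invr_gt0 mulr_gt0.
have dl1 : dl <= 1 by rewrite invf_le1 ?mulr_gt0 //; lra.
have [small|big] := ltP (dl * mu) 2.
  by exists 1%N; split => //; rewrite ?exp1n //; lra.
have := truncn_itv (le_trans (ler0n R 2) big); set M := Num.truncn _ => /andP[Mle Mgt].
have M0 : (0 < M)%N.
  by rewrite lt0n; apply/eqP => M0; move: Mgt; rewrite M0; lra.
exists M; split => //; last first.
  have : M.+1%:R <= 2 * M%:R :> R by rewrite -natrM ler_nat; lia.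
  lra.
apply: (@leq_ltn_trans (2 * M ^ D)); first by rewrite leq_mul2r geq_minl orbT.
rewrite -(ltr_nat R) natrM natrX.
have H : M%:R ^+ D <= dl * (G * S%:R) :> R.
  apply: (@le_trans _ _ ((dl * mu) ^+ D)); first by rewrite lerXn2r ?nnegrE // (le_trans _ Mle).
  rewrite exprMn; apply: ler_pM; rewrite ?exprn_ge0 ?(ltW dl0) //.
  by rewrite -[X in _ <= X]expr1 ler_wiXn2l // ltW.
apply: le_lt_trans (_ : 2 * (dl * (G * S%:R)) < _); first by rewrite ler_pM2l.
have -> : 2 * (dl * (G * S%:R)) = 2 / 3 * S%:R :> R.
  by rewrite /dl; field; rewrite gt_eqF.
have : 0 < S%:R :> R by rewrite ltr0n (leq_trans _ S2).
lra.
Qed.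

Theorem theorem2p2 (R : realType) (d : nat) (hd : (5 <= d)%N) :
  exists c C C' K : R, [/\ 0 < c, 0 < C, 0 < C' & 0 < K] /\
    forall lam r : R, 1 <= lam -> (exists n : nat, lam ^+ 2 = n%:R) ->
      0 < r -> r <= c * lam `^ (- (d%:R - 1)^-1) ->
      (observability d lam r <=
        (K * (C' * r * lam `^ (d%:R - 1)^-1)
             `^ (C * lam `^ ((d%:R - 2) / (d%:R - 1))))%:E)%E.
Proof.
have [e e0 ->] : exists2 e, (0 < e)%N & d = (4 + e)%N by exists (d - 4)%N; lia.
pose D := (3 + e)%N.
have dE : (4 + e)%:R - 1 = D%:R :> R by rewrite -[(4 + e)%N]/D.+1 mulrSr addrK.
have dE2 : (4 + e)%:R - 2 = e.+2%:R :> R.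
  by rewrite -[(4 + e)%N]/e.+4 !mulrSr; ring.
have D0 : 0 < D%:R :> R by rewrite ltr0n.
rewrite dE dE2.
pose G : R := (24 * (6 * e) ^ e)%N%:R.
have G1 : 1 <= G by rewrite ler1n muln_gt0 expn_gt0 muln_gt0 e0.
pose dl := (3 * G)^-1.
have dl0 : 0 < dl by rewrite invr_gt0 mulr_gt0 // (lt_le_trans _ G1).
(* Chosen so that the base 2^D e lam r / M is at most C' r lam^(1/D), given lam^((d-2)/D) <= 2 M /
   [dl]. *)
pose C' : R := 2 ^+ D * (expR 1 * (2 / dl)).
have C'0 : 0 < C' by rewrite mulr_gt0 ?exprn_gt0 // mulr_gt0 ?expR_gt0 ?divr_gt0.
exists C'^-1, dl, C', 6; split; first by split => //; rewrite invr_gt0.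
move=> lam r lam1 [n lamE] r0 rle.
have lam0 : 0 < lam by apply: lt_le_trans lam1.
(* lam factors as mu nu, and mu^D = lam^(d-2) is the order of the number of points on the sphere. *)
set nu := lam `^ D%:R^-1; set mu := lam `^ (e.+2%:R / D%:R).
have nu0 : 0 < nu by exact: powR_gt0.
have mu0 : 0 < mu by exact: powR_gt0.
have munu : mu * nu = lam.
  rewrite -powRD; last by apply/implyP => _; rewrite gt_eqF.
  by rewrite -{2}[D%:R^-1]mul1r -mulrDl -mulrSr mulfV ?gt_eqF // powRr1 // ltW.
have muD : mu ^+ D = lam ^+ e.+2.
  by rewrite -powR_mulrn ?(ltW mu0) // -powRrM mulfVK ?gt_eqF // powR_mulrn // ltW.
(* The choice c = 1 / C' keeps the base at most 1, so that the exponent 2 M can be lowered to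
   [dl * mu] at the end. *)
have X1 : C' * r * nu <= 1.
  rewrite -mulrA mulrC -ler_pdivlMr // mul1r -ler_pdivlMr //.
  by move: rle; rewrite powRN.
have [s [us ns s2 sG]] := sphere_points_growth e0 lam1 lamE.
have [|M [M0 MS dlmu]] := @vanishing_order_exists R D (size s) G mu isT G1 (ltW mu0) s2.
  by rewrite muD.
(* Only one more point than there are conditions is kept, so that N is bounded in terms of M. *)
pose N := (minn 2 M * M ^ D).+1.
pose K (l : 'I_N) : 'rV[int]_D.+1 := nth 0 s l.
have lts (l : 'I_N) : (l < size s)%N by apply: leq_trans (ltn_ord l) MS.
have normK l : \sum_i K l ord0 i ^+ 2 = n%:Z by apply: ns; rewrite mem_nth.
have injK : injective K.
  by move=> l m /eqP; rewrite nth_uniq // => /eqP /val_inj.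
have [a a0 van] := @exists_vanishing_moments R D N M _ K normK (ltnSn _).
apply: le_trans (observability_le_vanishing (ltW lam0) (ltW r0) lamE injK normK a0 van) _.
rewrite lee_fin; apply: le_trans (vanishing_bound_simpl D M0 _) _.
  by rewrite mulr_ge0 // ltW.
rewrite ler_pM2l //.
have MR : 0 < M%:R :> R by rewrite ltr0n.
have X0 : 0 < C' * r * nu by apply: mulr_gt0 nu0; exact: mulr_gt0.
apply: (@le_trans _ _ ((C' * r * nu) ^+ (2 * M))).
  rewrite lerXn2r // ?nnegrE ?(ltW X0) //.
    by rewrite mulr_ge0 ?exprn_ge0 // divr_ge0 // mulr_ge0 ?expR_ge0 // mulr_ge0 // ltW.
  have assoc (w x y : R) : w * (x * y) * r * nu = w * (x * (y * r * nu)) by ring.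
  rewrite /C' assoc -[expR 1 * _ / _]mulrA ler_pM2l ?exprn_gt0 // ler_pM2l ?expR_gt0 //.
  rewrite ler_pdivrMr //.
  have muM : mu <= 2 / dl * M%:R by rewrite mulrAC ler_pdivlMr // mulrC.
  have -> : lam * r = mu * (r * nu) by rewrite -munu; ring.
  have -> : 2 / dl * r * nu * M%:R = 2 / dl * M%:R * (r * nu) by ring.
  by rewrite ler_wpM2r // mulr_ge0 // ltW.
rewrite -powR_mulrn ?(ltW X0) //; apply: ger_powR; first by rewrite X0 X1.
by rewrite natrM.
Qed.
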